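(* Let $p$ be a prime, $\mathbb{F}$ a field of characteristic $p$, $n$ a positive integer, and suppose $k\ge0$ is an integer satisfying $n-2k\in\{0,1,\dots,p-2\}$. Then a basis of the slash homology group $H_k^{/0}=\mathrm{Ker}(\varphi_k)/\mathrm{Im}(\varphi_{k+p-1}^{p-1})$ is given by $$\big\{\,[\pmb{e}_{\mathtt t}]\ \big|\ \mathtt t\text{ is a }p\text{-standard tableau of shape }(n-k,k)\big\},$$ where $[v]$ denotes $v+\mathrm{Im}(\varphi_{k+p-1}^{p-1})\in H_k^{/0}$ for $v\in\mathrm{Ker}(\varphi_k)$. In particular, $D^{(n-k,k)}$ has a basis given by $$\{\pmb{e}_{\mathtt t}+\mathrm{rad}\,S^{(n-k,k)}\mid\mathtt t\text{ is a }p\text{-standard tableau of shape }(n-k,k)\}.$$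
   Context: Modules are right modules and maps are written on the right. $\Omega_k$ is the set of $k$-element subsets of $\{1,\dots,n\}$; $\mathbb{F}\Omega_k$ is the $\mathbb{F}$-vector space with basis $\Omega_k$ (zero for $k\notin\{0,\dots,n\}$), with the natural action of the symmetric group $\mathfrak{S}_n$. The map $\varphi_k:\mathbb{F}\Omega_k\to\mathbb{F}\Omega_{k-1}$ sends $\omega$ to $\sum_{\omega'\subset\omega,|\omega'|=k-1}\omega'$; $\varphi_{k+p-1}^{p-1}:\mathbb{F}\Omega_{k+p-1}\to\mathbb{F}\Omega_k$ is the composition of $p-1$ consecutive such maps; one has $\varphi^p=0$. An $(n-k,k)$-tableau $\mathtt t$ is a bijective filling by $1,\dots,n$ of the two-row Young diagram with rows of lengths $n-k$ and $k$; $\mathtt t_{i,j}$ is the entry in row $i$ (from top), column $j$ (from left). It is standard if entries increase along rows (left to right) and down columns. Put $\{\mathtt t\}:=\{\mathtt t_{2,1},\dots,\mathtt t_{2,k}\}\in\Omega_k$. The polytabloid of $\mathtt t$ is $\pmb{e}_{\mathtt t}=\sum_{\sigma\in C_{\mathtt t}}\mathrm{sgn}(\sigma)\{\mathtt t\}\sigma\in\mathbb{F}\Omega_k$, where $C_{\mathtt t}=\prod_{j=1}^k\langle(\mathtt t_{1,j},\mathtt t_{2,j})\rangle\le\mathfrak{S}_n$. The Specht module $S^{(n-k,k)}$ is the submodule of $\mathbb{F}\Omega_k$ spanned by all polytabloids of $(n-k,k)$-tableaux; it is contained in $\mathrm{Ker}(\varphi_k)$. The module $D^{(n-k,k)}$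 is the top $S^{(n-k,k)}/\mathrm{rad}\,S^{(n-k,k)}$ of the Specht module, which is irreducible when $p\neq2$. For $n-2k\in\{0,\dots,p-2\}$, an $(n-k,k)$-tableau $\mathtt t$ is $p$-standard if it is standard and $\mathtt t_{2,j}<\mathtt t_{1,j+p-2}$ for all $j\in\{1,2,\dots,n-k-(p-2)\}$.
   Formalization: The claim about the basis of D^{(n-k,k)} is stated only for p ≠ 2: for p = 2 one has n = 2k and there are no 2-standard tableaux, while the top S/rad S of the nonzero Specht module is nonzero (e.g. n = 2, k = 1), so the claim fails there. *)

(* Defs.v *)
From HB Require Import structures.
From mathcomp Require Import all_boot all_fingroup all_algebra.
From mathcomp Require Import boolp.

Set Implicit Arguments.
Unset Strict Implicit.
Unset Printing Implicit Defensive.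

Import GRing.Theory.
Local Open Scope ring_scope.
Local Open Scope quotient_scope.

Section QuotientSpace.

Variables (F : fieldType) (vT : vectType F).
Implicit Types U W : {vspace vT}.

(* The space vT / W: mathcomp's quotient zmodType of vT by the subgroup W,
   extended below to a vectType. *)
Definition vquot W : Type := Quotient.quot (pred_of_vspace W).

HB.instance Definition _ W := Choice.on (vquot W).
HB.instance Definition _ W := GRing.Zmodule.on (vquot W).

Definition vpi W (v : vT) : vquot W := \pi_(Quotient.quot (pred_of_vspace W)) v.

Lemma vpi_eq W u v : (vpi W u == vpi W v) = (u - v \in W).
Proof. by rewrite -/(Quotient.equiv (pred_of_vspace W) u v) piE. Qed.

Lemma vpiD W u v : vpi W (u + v) = vpi W u + vpi W v.
Proof. exact: (raddfD (\pi_(Quotient.quot (pred_of_vspace W)))). Qed.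

Definition vquot_repr W (x : vquot W) : vT :=
  generic_quotient.repr (x : Quotient.quot (pred_of_vspace W)).

Lemma vquot_reprK W (x : vquot W) : vpi W (vquot_repr x) = x.
Proof. exact: (@reprK _ (Quotient.quot (pred_of_vspace W))). Qed.

Definition vquot_scale W (a : F) (x : vquot W) : vquot W :=
  vpi W (a *: vquot_repr x).

Lemma vpiZ W a v : vpi W (a *: v) = vquot_scale a (vpi W v).
Proof.
apply/eqP; rewrite vpi_eq -scalerBr; apply: rpredZ.
by rewrite -vpi_eq vquot_reprK.
Qed.

Section Scale.
Variable W : {vspace vT}.

Fact vquot_scaleA a b (x : vquot W) :
  vquot_scale a (vquot_scale b x) = vquot_scale (a * b) x.
Proof. by rewrite -[x]vquot_reprK -!vpiZ scalerA. Qed.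

Fact vquot_scale1 : left_id 1 (@vquot_scale W).
Proof. by move=> x; rewrite -[x in LHS]vquot_reprK -vpiZ scale1r vquot_reprK. Qed.

Fact vquot_scaleDr : right_distributive (@vquot_scale W) +%R.
Proof.
move=> a x y; rewrite -[x]vquot_reprK -[y]vquot_reprK.
by rewrite -vpiD -!vpiZ scalerDr vpiD.
Qed.

Fact vquot_scaleDl (x : vquot W) :
  {morph (@vquot_scale W)^~ x : a b / a + b}.
Proof.
by move=> a b; rewrite /= -[x]vquot_reprK -!vpiZ scalerDl vpiD.
Qed.

HB.instance Definition _ := GRing.Zmodule_isLmodule.Build F (vquot W)
  vquot_scaleA vquot_scale1 vquot_scaleDr vquot_scaleDl.

Fact vpi_is_linear : linear (vpi W).
Proof. by move=> a u v; rewrite vpiD vpiZ. Qed.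

HB.instance Definition _ := GRing.isLinear.Build F vT (vquot W) _ (vpi W)
  vpi_is_linear.

Lemma vpi_eq0 v : (vpi W v == 0) = (v \in W).
Proof. by rewrite -(linear0 (vpi W)) vpi_eq subr0. Qed.

Fact vquot_vect_iso : Vector.axiom (\dim W^C) (vquot W).
Proof.
pose g v := daddv_pi W^C W v.
have capW : (W^C :&: W = 0)%VS by rewrite capvC capv_compl.
have gE v : vpi W (g v) = vpi W v.
  apply/eqP; rewrite eq_sym vpi_eq.
  have {1}<- : g v + daddv_pi W W^C v = v.
    by apply: daddv_pi_add; rewrite // addvC addv_complf memvf.
  by rewrite addrC addKr memv_pi.
have gW v : v \in W -> g v = 0.
  move=> Wv; apply/eqP; rewrite -memv0 -capW memv_cap memv_pi /=.
  by rewrite -vpi_eq0 gE vpi_eq0.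
have g_eq u v : vpi W u = vpi W v -> g u = g v.
  move/eqP; rewrite vpi_eq => /gW; rewrite /g linearB /= => /eqP.
  by rewrite subr_eq0 => /eqP.
exists (fun x => \row_i coord (vbasis W^C) i (g (vquot_repr x))).
  move=> a x y; apply/rowP=> i; rewrite !mxE -linearP /=; congr (coord _ _ _).
  rewrite -[RHS](linearP (daddv_pi W^C W)); apply: g_eq.
  by rewrite vquot_reprK linearP /= !vquot_reprK.
exists (fun r : 'rV_(\dim W^C) => vpi W (\sum_i r 0 i *: (vbasis W^C)`_i)).
  move=> x; rewrite -[RHS]vquot_reprK -[RHS]gE; congr vpi.
  rewrite [RHS](coord_vbasis (memv_pi _ _ _)).
  by apply: eq_bigr => i _; rewrite mxE.
move=> r; apply/rowP=> i; rewrite mxE.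
rewrite (g_eq _ (\sum_i r 0 i *: (vbasis W^C)`_i)) ?vquot_reprK //.
rewrite /g daddv_pi_id //; first by rewrite coord_sum_free ?(basis_free (vbasisP _)).
by apply: rpred_sum => j _; rewrite rpredZ ?vbasis_mem ?memt_nth.
Qed.

HB.instance Definition _ := Lmodule_hasFinDim.Build F (vquot W) vquot_vect_iso.

End Scale.

(* U / W for W <= U, as a subspace of vT / W *)
Definition subquot U W : {vspace vquot W} := (linfun (vpi W) @: U)%VS.

End QuotientSpace.

Section SymmetricGroupModule.

Variables (F : fieldType) (n : nat).

(* The direct sum of all the F Omega_k: the space with basis the subsets of
   'I_n, which stands for {1, ..., n}. *)
Definition subsetMod := {ffun {set 'I_n} -> F^o}.

HB.instance Definition _ := Vector.on subsetMod.

Definition subsetVec (A : {set 'I_n}) : subsetMod := [ffun B => (B == A)%:R].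

Definition linExt (f : {set 'I_n} -> subsetMod) (v : subsetMod) : subsetMod :=
  \sum_(A : {set 'I_n}) (v A : F) *: f A.

Fact linExt_is_linear f : linear (linExt f).
Proof.
move=> a u v; rewrite /linExt scaler_sumr -big_split /=.
by apply: eq_bigr => A _; rewrite !ffunE scalerDl scalerA.
Qed.

HB.instance Definition _ f :=
  GRing.isLinear.Build F subsetMod subsetMod _ (linExt f) (linExt_is_linear f).

Lemma linExt_subsetVec f A : linExt f (subsetVec A) = f A.
Proof.
rewrite /linExt (bigD1 A) //= big1 => [|B neqBA]; rewrite !ffunE.
  by rewrite eqxx scale1r addr0.
by rewrite (negPf neqBA) scale0r.
Qed.

Definition Omega (k : nat) : {set {set 'I_n}} :=
  [set A : {set 'I_n} | #|A| == k].

Definition FOmega (k : nat) : {vspace subsetMod} :=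
  <<[seq subsetVec A | A in Omega k]>>%VS.

(* All the phi_k at once; in particular phi vanishes on FOmega 0. *)
Definition phi : 'End(subsetMod) :=
  linfun (linExt (fun A =>
    \sum_(B : {set 'I_n} | (B \subset A) && (#|B|.+1 == #|A|)) subsetVec B)).

Definition phi_iter (m : nat) : 'End(subsetMod) :=
  iter m (fun f => (phi \o f)%VF) \1%VF.

Definition Ker_phi (k : nat) : {vspace subsetMod} := (FOmega k :&: lker phi)%VS.

Definition Im_phi_iter (m k : nat) : {vspace subsetMod} :=
  (phi_iter m @: FOmega k)%VS.

(* Products in 'S_n are composed left to right, so this is a right action. *)
Definition permAct (s : 'S_n) : 'End(subsetMod) :=
  linfun (linExt (fun A => subsetVec (s @: A))).

Definition submodule (U : {vspace subsetMod}) : Prop :=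
  forall s : 'S_n, (permAct s @: U <= U)%VS.

Definition maximal_submodule (U M : {vspace subsetMod}) : Prop :=
  [/\ submodule M, (M <= U)%VS, M <> U &
      forall N, submodule N -> (M <= N)%VS -> (N <= U)%VS -> N = M \/ N = U].

Lemma jrad_exists (U : {vspace subsetMod}) : exists R : {vspace subsetMod},
  forall v, v \in R <-> v \in U /\ forall M, maximal_submodule U M -> v \in M.
Proof.
pose inR v := v \in U /\ forall M, maximal_submodule U M -> v \in M.
pose P d := `[< exists R : {vspace subsetMod},
  (forall v, v \in R -> inR v) /\ \dim R = d >].
have exP : exists d, P d.
  exists 0%N; apply/asboolP; exists 0%VS; rewrite dimv0; split=> // v.
  by rewrite memv0 => /eqP->; split=> [|M _]; apply: mem0v.
have ubP d : P d -> (d <= \dim {:subsetMod})%N.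
  by case/asboolP=> R [_ <-]; apply/dimvS/subvf.
case: (ex_maxnP exP ubP) => d /asboolP[R [RP dimR]] maxd.
exists R => v; split=> [/RP //|inRv].
have : P (\dim (R + <[v]>)%VS).
  apply/asboolP; exists (R + <[v]>)%VS; split=> // w.
  case/memv_addP=> u /RP[uU uM] [_ /vlineP[a ->] ->].
  case: inRv => vU vM.
  split=> [|M maxM]; apply: rpredD; rewrite ?rpredZ //; first exact: uM.
  exact: vM.
move/maxd; rewrite -dimR => dimle.
have /eqP-> : R == (R + <[v]>)%VS by rewrite eqEdim addvSl dimle.
exact: (subvP (addvSr _ _)) (memv_line v).
Qed.

(* The Jacobson radical: the intersection of all maximal submodules. *)
Definition jrad (U : {vspace subsetMod}) : {vspace subsetMod} :=
  projT1 (cid (jrad_exists U)).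

Lemma jradP (U : {vspace subsetMod}) v :
  v \in jrad U <-> v \in U /\ forall M, maximal_submodule U M -> v \in M.
Proof. exact: (projT2 (cid (jrad_exists U))). Qed.

Section Tableaux.

Variable k : nat.

(* Fillings of the two-row diagram: inl and inr are the top and bottom rows.
   Columns and entries are numbered from 0. *)
Definition filling := {ffun 'I_(n - k) + 'I_k -> 'I_n}.

Definition tableau : {set filling} :=
  [set t : filling | injectiveb t && [forall i, i \in codom t]].

Definition top (t : filling) (j : 'I_(n - k)) : 'I_n := t (inl j).
Definition bot (t : filling) (j : 'I_k) : 'I_n := t (inr j).

Definition standard (t : filling) : bool :=
  [&& [forall i : 'I_(n - k), forall j : 'I_(n - k),
         (i < j)%N ==> (top t i < top t j)%N],
      [forall i : 'I_k, forall j : 'I_k, (i < j)%N ==> (bot t i < bot t j)%N] &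
      [forall i : 'I_(n - k), forall j : 'I_k,
         (i == j :> nat) ==> (top t i < bot t j)%N]].

(* When n - 2k <= p - 2, the columns j + (p - 2) <= n - k of the top row are
   exactly those constrained in the definition of p-standard tableaux. *)
Definition pstandard (p : nat) : {set filling} :=
  [set t in tableau | standard t &&
     [forall j : 'I_k, forall i : 'I_(n - k),
        (i == j + (p - 2) :> nat)%N ==> (bot t j < top t i)%N]].

Definition tabset (t : filling) : {set 'I_n} := [set bot t j | j : 'I_k].

Definition colstab (t : filling) : {set 'S_n} :=
  (\prod_(c : 'I_(n - k) * 'I_k | c.1 == c.2 :> nat)
     <[tperm (top t c.1) (bot t c.2)]>)%g.

Definition polytabloid (t : filling) : subsetMod :=
  \sum_(s in colstab t) (-1) ^+ odd_perm s *: permAct s (subsetVec (tabset t)).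

Definition Specht : {vspace subsetMod} :=
  <<[seq polytabloid t | t in tableau]>>%VS.

End Tableaux.

End SymmetricGroupModule.

Arguments subsetVec F {n} A.
Arguments polytabloid F {n k} t.

(* Main.v *)
Require Import Defs.
From HB Require Import structures.
From mathcomp Require Import all_boot all_fingroup all_algebra.
From mathcomp Require Import cyclic ring zify.

Set Implicit Arguments.
Unset Strict Implicit.
Unset Printing Implicit Defensive.

Import GRing.Theory.
Local Open Scope ring_scope.

(** Write [phi] and [raise] for the operators on the span of all subsets that
    remove, respectively insert, one point: together they make it the tensor
    power of the natural module of sl2.  Everything is done by adding one point
    at a time, [m] being the number of points already present.

    Spanning.  Write [z] in the kernel of [phi] as [x + ins m y]; then
    [phi y = 0], so by induction [y] is a combination of polytabloids of
    p-standard tableaux modulo the image of [phi^(p-1)].  Putting the new point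
    at the end of the bottom row of these tableaux lifts them to [m+1] points,
    and correcting [z] accordingly leaves a vector of the kernel that avoids the
    new point.  The induction stays in the strip [0 <= m - 2k <= p - 2] because
    on its two borders, where [m - 2k = -1] in [F], the kernel of [phi] is
    contained in the image of [phi^(p-1)]: a lowest weight vector [v] of weight
    [-1] is a nonzero multiple of [phi^(p-1) (raise^(p-1) v)].

    Independence.  The lowest weight vectors [u] with [raise^(m-2k+1) u = 0] are
    orthogonal to the image of [phi^(p-1)], and they are stable under the two
    operations [u] and [(m-2k) ins m u - raise u] that add a point.  Pairing
    p-standard polytabloids with them is triangular, with diagonal entries
    products of factors [m-2k+1 < p].

    The top of the Specht module [S].  By James' submodule theorem a submodule
    contains [S] or is orthogonal to it.  Hence the image of [phi^(p-1)] is
    orthogonal to [S], and by the two previous points the elements of [S]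
    orthogonal to [S] are exactly those in the image; they form the unique
    maximal submodule of [S]. *)

Lemma span_ind (F : fieldType) (vT : vectType F) (X : seq vT) (P : vT -> Prop) v :
  P 0 -> (forall a x u, x \in X -> P u -> P (a *: x + u)) ->
  v \in <<X>>%VS -> P v.
Proof.
move=> P0; elim: X v => [|x X IHX] v PX; first by rewrite span_nil memv0 => /eqP->.
rewrite span_cons => /memv_addP[_ /vlineP[a ->] [u Xu ->]].
apply: (PX); first exact: mem_head.
by apply: IHX Xu => b y w Xy; apply: PX; rewrite inE Xy orbT.
Qed.

(** * Insertion and removal of a point *)

Section Operators.

Variables (F : fieldType) (n : nat).
Local Notation V := (subsetMod F n).
Implicit Types (x y : 'I_n) (A B : {set 'I_n}) (u v w : V) (m k : nat).

Lemma subsetVecE A B : subsetVec F A B = (B == A)%:R.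
Proof. by rewrite ffunE. Qed.

Lemma subsetVec_sum v : v = \sum_A (v A : F) *: subsetVec F A.
Proof.
apply/ffunP=> B; rewrite sum_ffunE (bigD1 B) //= big1 => [|A neqAB].
  by rewrite !ffunE eqxx addr0 /GRing.scale /= mulr1.
by rewrite !ffunE eq_sym (negPf neqAB) scaler0.
Qed.

Lemma mem_span_subsetVec (P : {set {set 'I_n}}) v :
  reflect (forall A, A \notin P -> v A = 0)
          (v \in <<[seq subsetVec F A | A in P]>>%VS).
Proof.
apply: (iffP idP) => [Pv A PA|v0].
  apply: (span_ind (P := fun v : V => v A = 0)) Pv => [|a e u]; first by rewrite ffunE.
  case/imageP=> B PB -> u0; rewrite !ffunE u0 addr0.
  by case: eqP PA => [->|]; rewrite ?PB // scaler0.
rewrite [v]subsetVec_sum; apply: rpred_sum => A _.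
case: (boolP (A \in P)) => [PA|/v0->]; last by rewrite scale0r mem0v.
by rewrite rpredZ // memv_span //; apply: image_f.
Qed.

(** In terms of basis sets, [ins x] sends A to [x |: A] if x is not in A, and to 0 otherwise;
    [del x] is its transpose. They are the raising and lowering operators of sl2 in the tensor
    factor of x. *)
Definition ins x v : V := [ffun A : {set 'I_n} => if x \in A then v (A :\ x) else 0].
Definition del x v : V := [ffun A : {set 'I_n} => if x \in A then 0 else v (x |: A)].

Fact ins_is_linear x : linear (ins x).
Proof.
move=> a u v; apply/ffunP=> A; rewrite !ffunE.
by case: ifP => _; rewrite ?ffunE // scaler0 addr0.
Qed.
HB.instance Definition _ x :=
  GRing.isLinear.Build F V V _ (ins x) (ins_is_linear x).

Fact del_is_linear x : linear (del x).
Proof.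
move=> a u v; apply/ffunP=> A; rewrite !ffunE.
by case: ifP => _; rewrite ?ffunE // scaler0 addr0.
Qed.
HB.instance Definition _ x :=
  GRing.isLinear.Build F V V _ (del x) (del_is_linear x).

Definition avoids x v := forall A, x \in A -> v A = 0.

Lemma insK x v : ins x (ins x v) = 0.
Proof. by apply/ffunP=> A; rewrite !ffunE setD11; case: ifP. Qed.

Lemma insC x y v : ins x (ins y v) = ins y (ins x v).
Proof.
apply/ffunP=> A; rewrite !ffunE !in_setD1.
have [->|neq_xy] := eqVneq x y; first by [].
by rewrite setDDl setDDl setUC; case: (x \in A); case: (y \in A).
Qed.

Lemma del_ins_neq x y v : x != y -> del x (ins y v) = ins y (del x v).
Proof.
move=> neq_xy; apply/ffunP=> A; rewrite !ffunE in_setU1 in_setD1 neq_xy.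
rewrite (eq_sym y) (negPf neq_xy) /=.
case: ifP => xA; case: ifP => yA //.
congr (v _); apply/setP=> z; rewrite !inE.
by case: (eqVneq z x) => [->|//]; rewrite neq_xy.
Qed.

Lemma del_ins x v : avoids x v -> del x (ins x v) = v.
Proof.
move=> xv; apply/ffunP=> A; rewrite !ffunE setU11.
by case: ifP => xA; [rewrite xv | rewrite setU1K ?xA].
Qed.

Lemma del_avoids x v : avoids x v -> del x v = 0.
Proof.
by move=> xv; apply/ffunP=> A; rewrite !ffunE; case: ifP => // _; rewrite xv ?setU11.
Qed.

Lemma avoids_ins x y v : x != y -> avoids x v -> avoids x (ins y v).
Proof.
move=> neq_xy xv A xA; rewrite ffunE; case: ifP => // _.
by rewrite xv // in_setD1 neq_xy.
Qed.

Lemma avoidsB x u v : avoids x u -> avoids x v -> avoids x (u - v).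
Proof. by move=> xu xv A xA; rewrite !ffunE xu // xv // subr0. Qed.

(** This is the Cartan element in the factor of x: eigenvalue 1 on sets without x, and -1 on sets
    with x. *)
Lemma commutator_del_ins x v A :
  (del x (ins x v) - ins x (del x v)) A = v A - (v A *+ (x \in A)) *+ 2.
Proof.
rewrite !ffunE setU11 in_setD1 eqxx /=.
case: ifP => xA; rewrite ?setD1K // ?setU1K ?xA // ?subr0 ?mul0rn ?subr0 //.
by rewrite sub0r mulr2n opprD addNKr.
Qed.

(** A set C obtained from A by removing one point determines that point, so the sum over C is a sum
    over points. From here on [phi] is a sum of local operators. *)
Lemma phiE v : phi F n v = \sum_x del x v.
Proof.
apply/ffunP=> B; rewrite lfunE /= /linExt [v in RHS]subsetVec_sum.
rewrite (eq_bigr (fun x => \sum_A (v A : F) *: del x (subsetVec F A))); last first.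
  by move=> x _; rewrite linear_sum; apply: eq_bigr => A _; rewrite linearZ.
rewrite exchange_big; congr (fun_of_fin _ B); apply: eq_bigr => A _.
rewrite -scaler_sumr; congr (_ *: _); apply/ffunP=> C.
rewrite !sum_ffunE.
rewrite (eq_bigr (fun x => if (x \notin C) && (x |: C == A) then 1 else 0 : F^o)); last first.
  by move=> x _; rewrite !ffunE; case: (x \in C) => //=; case: ifP.
rewrite (eq_bigr (fun X : {set 'I_n} => if X == C then 1 else 0 : F^o)); last first.
  by move=> X _; rewrite ffunE eq_sym; case: ifP.
rewrite -!big_mkcondr /=.
case: (boolP ((C \subset A) && (#|C|.+1 == #|A|))) => [/andP[sCA cA]|nCA].
  have /cards1P[x Ax] : #|A :\: C| == 1%N.
    by rewrite cardsD (setIidPr sCA) -(eqP cA) subSn // subnn.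
  have [xC xA] : x \notin C /\ x \in A.
    by move/setP/(_ x): Ax; rewrite !inE eqxx => /andP[].
  rewrite (big_pred1 C) => [|X]; last first.
    by apply/andP/eqP=> [[_ /eqP]//|->]; rewrite sCA cA.
  rewrite (big_pred1 x) // => y /=; apply/andP/eqP=> [[yC /eqP eA]|->].
    by apply/set1P; rewrite -Ax -eA in_setD yC setU11.
  split=> //; rewrite eqEsubset subUset sub1set xA sCA.
  by rewrite -Ax setUC; apply/subsetP=> z zA; rewrite !inE zA andbT orbN.
rewrite !big_pred0 // => [y|X].
  apply/negP=> /andP[yC /eqP eA]; case/negP: nCA.
  by rewrite -eA subsetUr cardsU1 yC eqxx.
by apply/negP=> /andP[PX /eqP eX]; rewrite -eX PX in nCA.
Qed.

End Operators.

(** * Linearity of the iterates of a linear map *)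

Section Iter.

Variables (F : fieldType) (V : lmodType F) (f : {linear V -> V}) (j : nat).

Fact iter_is_linear : linear (iter j f).
Proof.
move=> a u v; elim: (j) => //= i ->.
by rewrite linearP.
Qed.
HB.instance Definition _ :=
  GRing.isLinear.Build F V V _ (iter j f) iter_is_linear.

End Iter.

Lemma card_ltn_ord n m : (m <= n)%N -> #|[pred x : 'I_n | (x < m)%N]| = m.
Proof.
by move=> le_mn; rewrite -sum1_card (big_ord_narrow le_mn) sum1_card card_ord.
Qed.

(** * The sl2 action on the subsets of the first m points *)

Section Prefix.

Variables (F : fieldType) (n : nat).
Local Notation V := (subsetMod F n).
Local Notation phi := (phi F n).
Implicit Types (x y : 'I_n) (A B : {set 'I_n}) (u v w : V) (m k j : nat).

(** The sets of size k among the first m points, kept inside the space for all n points, so that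
    induction on m never changes the ambient space. *)
Definition prefixSpace m k : {vspace V} :=
  <<[seq subsetVec F A | A in
     [set A : {set 'I_n} | (#|A| == k) && [forall x in A, x < m]%N]]>>%VS.

Local Notation W := prefixSpace.

Lemma memW m k v :
  reflect (forall A, v A != 0 -> #|A| = k /\ forall x, x \in A -> (x < m)%N)
          (v \in W m k).
Proof.
apply: (iffP (mem_span_subsetVec _ _)) => Wv A.
  move=> vA; have: A \in [set A : {set 'I_n} | (#|A| == k) && [forall x in A, x < m]%N].
    by apply: contraNT vA => /Wv/eqP.
  by rewrite inE => /andP[/eqP-> /forall_inP].
apply: contraNeq => /Wv[cA mA].
by rewrite inE cA eqxx; apply/forall_inP.
Qed.

Lemma FOmegaE k : FOmega F n k = W n k.
Proof.
rewrite /FOmega /prefixSpace (_ : Omega n k =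
  [set A : {set 'I_n} | (#|A| == k) && [forall x in A, x < n]%N]) //.
apply/setP=> A; rewrite !inE; case: (#|A| == k) => //=.
by apply/esym/forall_inP=> x _.
Qed.

Lemma avoids_W m k v x : v \in W m k -> (m <= x)%N -> avoids x v.
Proof.
move=> /memW Wv le_mx A xA; apply/eqP; apply: contraLR le_mx => /Wv[_ /(_ x xA)].
by rewrite ltnNge.
Qed.

Lemma W_mono m m' k v : (m <= m')%N -> v \in W m k -> v \in W m' k.
Proof.
move=> le_m /memW Wv; apply/memW=> A /Wv[-> mA]; split=> // x /mA lt_xm.
exact: leq_trans le_m.
Qed.

Lemma ins_W m k v x : (x < m)%N -> v \in W m k -> ins x v \in W m k.+1.
Proof.
move=> lt_xm /memW Wv; apply/memW=> A; rewrite ffunE.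
case: ifP => [xA|]; last by rewrite eqxx.
case/Wv=> cA mA; rewrite (cardsD1 x) xA cA; split=> // y yA.
by have [->//|neq_yx] := eqVneq y x; apply: mA; rewrite in_setD1 neq_yx.
Qed.

Lemma del_W m k v x : v \in W m k.+1 -> del x v \in W m k.
Proof.
move=> /memW Wv; apply/memW=> A; rewrite ffunE.
case: ifPn => [|xA]; first by rewrite eqxx.
case/Wv; rewrite cardsU1 xA add1n => [[->]] mA.
by split=> // y yA; rewrite mA // setU1r.
Qed.

Lemma del_W0 m v x : v \in W m 0 -> del x v = 0.
Proof.
move=> /memW Wv; apply/ffunP=> A; rewrite !ffunE; case: ifPn => // xA.
by apply/eqP; apply: contraT => /Wv[]; rewrite cardsU1 xA.
Qed.

Lemma phi_W m k v : v \in W m k.+1 -> phi v \in W m k.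
Proof. by move=> Wv; rewrite phiE rpred_sum // => x _; apply: del_W. Qed.

Lemma phi_W0 m v : v \in W m 0 -> phi v = 0.
Proof. by move=> Wv; rewrite phiE big1 // => x _; apply: del_W0 Wv. Qed.

Lemma phi_del x v : phi (del x v) = del x (phi v).
Proof.
rewrite !phiE linear_sum; apply: eq_bigr => y _; apply/ffunP=> A.
have [->//|neq_yx] := eqVneq y x.
rewrite !ffunE !in_setU1 setUCA (negPf neq_yx) eq_sym (negPf neq_yx) /=.
by case: (x \in A); case: (y \in A).
Qed.

Lemma iter_phi_W j m k v : v \in W m (k + j) -> iter j phi v \in W m k.
Proof.
elim: j v => [|j IHj] v Wv; first by rewrite addn0 in Wv.
by rewrite iterSr IHj // phi_W // -addnS.
Qed.

Lemma avoids_phi x v : avoids x v -> avoids x (phi v).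
Proof.
move=> xv A xA; rewrite phiE sum_ffunE big1 // => y _; rewrite ffunE.
by case: ifP => // _; rewrite xv // setU1r.
Qed.

Lemma split_last m k v x : val x = m -> v \in W m.+1 k ->
  v - ins x (del x v) \in W m k.
Proof.
move=> xm /memW Wv; apply/memW=> A; rewrite !ffunE setD11.
case: ifP => xA; first by rewrite setD1K // subrr eqxx.
rewrite subr0 => /Wv[cA mA]; split=> // y yA.
rewrite ltn_neqAle -ltnS mA // andbT -xm; apply: contraTneq yA => /val_inj->.
by rewrite xA.
Qed.

Lemma del_last_W m k v x : val x = m -> v \in W m.+1 k.+1 -> del x v \in W m k.
Proof.
move=> xm /(del_W x)/memW Wv; apply/memW=> A vA; have [-> mA] := Wv _ vA.
split=> // y yA; rewrite ltn_neqAle -ltnS mA // andbT -xm.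
by apply: contraNneq vA => /val_inj eyx; rewrite ffunE -eyx yA.
Qed.

Lemma phi_ins x v : avoids x v -> phi (ins x v) = ins x (phi v) + v.
Proof.
move=> xv; rewrite !phiE (bigD1 x) //= del_ins // addrC; congr (_ + _).
rewrite linear_sum [RHS](bigD1 x) //= del_avoids // linear0 add0r.
by apply: eq_bigr => y neq_yx; rewrite del_ins_neq.
Qed.

Lemma iter_phiD j : {morph iter j phi : u v / u + v}.
Proof. exact: (linearD (iter j phi)). Qed.

(** Each of the [j.+1] factors [phi] may be the one that removes x, and only one of them can; all
    these choices contribute the same vector. *)
Lemma iter_phi_ins j x v : avoids x v ->
  iter j.+1 phi (ins x v) = ins x (iter j.+1 phi v) + iter j phi v *+ j.+1.
Proof.
elim: j v => [|j IHj] v xv; first exact: phi_ins.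
rewrite iterSr phi_ins // iter_phiD IHj; last exact: avoids_phi.
by rewrite -!iterSr -addrA -mulrSr.
Qed.

(** The bound m makes this the raising operator of the first m tensor factors only. *)
Definition raise m v : V := \sum_(x : 'I_n | (x < m)%N) ins x v.

Fact raise_is_linear m : linear (raise m).
Proof.
move=> a u v; rewrite /raise scaler_sumr -big_split.
by apply: eq_bigr => x _; rewrite linearP.
Qed.
HB.instance Definition _ m :=
  GRing.isLinear.Build F V V _ (raise m) (raise_is_linear m).

Lemma raise_W m k v : v \in W m k -> raise m v \in W m k.+1.
Proof. by move=> Wv; rewrite rpred_sum // => x lt_xm; apply: ins_W. Qed.

Lemma iter_raise_W j m k v : v \in W m k -> iter j (raise m) v \in W m (k + j).
Proof.
move=> Wv; elim: j => [|j IHj]; first by rewrite addn0.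
by rewrite iterS addnS raise_W.
Qed.

Lemma iter_raiseB j m : {morph iter j (raise m) : u v / u - v}.
Proof. exact: (linearB (iter j (raise m))). Qed.

Lemma iter_raiseMn j m i : {morph iter j (raise m) : v / v *+ i}.
Proof. exact: (linearMn (iter j (raise m))). Qed.

Lemma ins_raise x m v : ins x (raise m v) = raise m (ins x v).
Proof. by rewrite linear_sum; apply: eq_bigr => y _; rewrite insC. Qed.

Lemma ins_iter_raise j x m v :
  ins x (iter j (raise m) v) = iter j (raise m) (ins x v).
Proof. by elim: j => //= j IHj; rewrite ins_raise IHj. Qed.

Lemma raiseS m x v : val x = m -> raise m.+1 v = raise m v + ins x v.
Proof.
move=> xm; rewrite /raise (bigD1 x) /=; last by rewrite xm.
rewrite addrC; congr (_ + _); apply: eq_bigl => y.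
by rewrite ltnS (ltn_neqAle y) -xm andbC.
Qed.

(** The binomial theorem for the commuting operators [raise m] and [ins x], where [ins x] squares to
    zero. *)
Lemma iter_raiseS j m x v : val x = m ->
  iter j.+1 (raise m.+1) v
  = iter j.+1 (raise m) v + ins x (iter j (raise m) v) *+ j.+1.
Proof.
move=> xm; elim: j => [|j IHj]; first exact: raiseS.
rewrite iterS IHj (raiseS _ xm) !linearD /= !linearMn /= insK mul0rn addr0.
by rewrite -addrA -ins_raise -mulrSr.
Qed.

(** The relation [e,f] = h of sl2. Operators at distinct points commute, and each of the m points
    contributes 1 if it is outside the set and -1 if it is one of its k elements. *)
Lemma phi_raise m k v : (m <= n)%N -> v \in W m k ->
  phi (raise m v) = raise m (phi v) + (m%:R - k.*2%:R) *: v.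
Proof.
move=> le_mn /memW Wv; apply/eqP; rewrite addrC -subr_eq; apply/eqP.
have comm x u : phi (ins x u) - ins x (phi u) = del x (ins x u) - ins x (del x u).
  rewrite !phiE linear_sum (bigD1 x) //= [in X in _ - X](bigD1 x) //=.
  rewrite opprD addrACA -sumrB big1 ?addr0 // => y neq_yx.
  by rewrite del_ins_neq ?subrr // eq_sym.
rewrite /raise linear_sum -sumrB; apply/ffunP=> A; rewrite sum_ffunE.
under eq_bigr => x _ do rewrite comm commutator_del_ins.
rewrite sumrB !ffunE sumr_const.
rewrite card_ltn_ord //.
have [->|vA] := eqVneq (v A) 0.
  by rewrite scaler0 mul0rn sub0r big1 ?oppr0 // => x _; rewrite !mul0rn.
have [cA mA] := Wv _ vA.
rewrite (eq_bigr (fun x => if x \in A then v A *+ 2 else 0)); last first.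
  by move=> x _; case: ifP => _; rewrite ?mulr1n ?mul0rn.
rewrite -big_mkcondr (eq_bigl (mem A)) => [|x]; last first.
  by apply/andP/idP=> [[]//|xA]; split; [apply: mA|].
by rewrite sumr_const cA -mulrnA mul2n /GRing.scale /= mulrBl !mulr_natl.
Qed.

(* Here phi and raise act as on the Steinberg module of sl2: the lowest weight
   is -1 in F, and phi (raise^(j+1) v) = - (j+1)^2 raise^j v. *)
Lemma kernel_sub_image p m k v : p \in [pchar F] -> (m <= n)%N ->
  m.+1%:R = k.*2%:R :> F -> v \in W m k -> phi v = 0 ->
  exists2 w, w \in W m (k + p.-1) & v = iter p.-1 phi w.
Proof.
move=> charF le_mn eq_mk Wv phiv.
have step j : phi (iter j.+1 (raise m) v) = - (j.+1 ^ 2)%:R *: iter j (raise m) v.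
  elim: j => [|j IHj].
    rewrite (phi_raise le_mn Wv) phiv linear0 add0r -eq_mk -natr1.
    by rewrite opprD addNKr.
  rewrite iterS (phi_raise le_mn (iter_raise_W j.+1 Wv)) IHj linearZ /= -scalerDl.
  congr (_ *: _); rewrite doubleD natrD -eq_mk -addnn natrD !natrX -!natr1; ring.
(* The scalar is (-1)^j (j!)^2, a product of the factors of [step], none of which vanishes below
   p. *)
have kill j : (j < p)%N ->
    exists2 c : F, c != 0 & iter j phi (iter j (raise m) v) = c *: v.
  elim: j => [|j IHj] lt_jp; first by exists 1; rewrite ?oner_neq0 ?scale1r.
  have [c nz_c IH] := IHj (ltnW lt_jp).
  exists (- (j.+1 ^ 2)%:R * c); last first.
    by rewrite iterSr step linearZ /= IH scalerA.
  rewrite mulf_neq0 // oppr_eq0 natrX expf_neq0 //.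
  by rewrite -(dvdn_pcharf charF) gtnNdvd.
have [|c nz_c kE] := kill p.-1; first by rewrite prednK ?prime_gt0 ?(pcharf_prime charF).
exists (c^-1 *: iter p.-1 (raise m) v); first by rewrite rpredZ ?iter_raise_W.
by rewrite linearZ /= kE scalerA mulVf ?scale1r.
Qed.

End Prefix.

(** * The invariant bilinear form and lowest weight vectors *)

Section Dot.

Variables (F : fieldType) (n : nat).
Local Notation V := (subsetMod F n).
Local Notation phi := (phi F n).
Local Notation W := (prefixSpace F n).
Implicit Types (x y : 'I_n) (A B : {set 'I_n}) (u v w : V) (m k j : nat).

Definition dot u v : F^o := \sum_A u A * v A.

Fact dot_is_linear u : linear (dot u).
Proof.
move=> a v w; rewrite /dot scaler_sumr -big_split; apply: eq_bigr => A _.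
by rewrite !ffunE mulrDr scalerAr.
Qed.
HB.instance Definition _ u :=
  GRing.isLinear.Build F V F^o _ (dot u) (dot_is_linear u).

Lemma dotC u v : dot u v = dot v u.
Proof. by apply: eq_bigr => A _; rewrite mulrC. Qed.

Lemma dotDl u v w : dot (u + v) w = dot u w + dot v w.
Proof. by rewrite dotC linearD /= !(dotC w). Qed.

Lemma dotBl u v w : dot (u - v) w = dot u w - dot v w.
Proof. by rewrite dotC linearB /= !(dotC w). Qed.

Lemma dot_suml I (r : seq I) (P : pred I) (f : I -> V) v :
  dot (\sum_(i <- r | P i) f i) v = \sum_(i <- r | P i) dot (f i) v.
Proof. by rewrite dotC linear_sum /=; apply: eq_bigr => i _; rewrite dotC. Qed.

Lemma dotZl a u v : dot (a *: u) v = a * dot u v.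
Proof. by rewrite dotC linearZ /= dotC. Qed.

Lemma dot_subsetVec A v : dot (subsetVec F A) v = v A.
Proof.
rewrite /dot (bigD1 A) //= big1 ?addr0 => [|B neqBA]; rewrite ffunE.
  by rewrite eqxx mul1r.
by rewrite (negPf neqBA) mul0r.
Qed.

Lemma dot_ins x u v : dot (ins x u) v = dot u (del x v).
Proof.
rewrite /dot (bigID (fun A => x \in A)) /= [in LHS]addrC.
rewrite big1 ?add0r => [|A xA]; last by rewrite ffunE (negPf xA) mul0r.
rewrite [RHS](bigID (fun A => x \in A)) /= [in RHS]big1 ?add0r => [|A xA]; last first.
  by rewrite ffunE xA mulr0.
rewrite (reindex_onto (fun A => x |: A) (fun A => A :\ x)) => [|A xA]; last exact: setD1K.
rewrite [LHS](eq_bigl (fun A => x \notin A)) => [|A]; last first.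
  rewrite setU11 /=; apply/eqP/idP=> [<-|]; [by rewrite setD11 | exact: setU1K].
by apply: eq_bigr => A xA; rewrite !ffunE setU11 (negPf xA) setU1K.
Qed.

Lemma dot_ins_avoids x u v : avoids x v -> dot (ins x u) v = 0.
Proof. by move=> xv; rewrite dot_ins del_avoids // linear0. Qed.

(** [ins x] and [del x] are adjoint by [dot_ins]. Points beyond m drop out because no set in the
    support of u contains them, which is why [raise m] suffices. *)
Lemma dot_phi m k u v : u \in W m k ->
  dot (phi u) v = dot u (raise m v).
Proof.
move=> Wu; rewrite phiE dot_suml linear_sum /= (bigID (fun x : 'I_n => (x < m)%N)) /=.
rewrite [X in _ + X]big1 ?addr0 => [|x]; last first.
  by rewrite -leqNgt => /(avoids_W Wu) xu; rewrite del_avoids // dotC linear0.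
by apply: eq_bigr => x _; rewrite dotC -dot_ins dotC.
Qed.

Lemma dot_iter_phi j k u v : u \in W n (k + j) ->
  dot (iter j phi u) v = dot u (iter j (raise n) v).
Proof.
elim: j u v => [//|j IHj] u v Wu.
rewrite addnS in Wu.
by rewrite iterSr IHj ?phi_W // (dot_phi _ Wu).
Qed.

(* In characteristic 0 the last condition follows from the other two. *)
Definition lowest_weight m k u :=
  [/\ u \in W m k, phi u = 0 & iter (m - k.*2).+1 (raise m) u = 0].

(** The exponent grows by one with m, so both terms of [iter_raiseS] contain enough factors
    [raise m] to kill u. *)
Lemma lowest_weight_up m k u x : val x = m -> (k.*2 <= m)%N -> lowest_weight m k u ->
  lowest_weight m.+1 k u.
Proof.
move=> xm le_km [Wu phiu eu]; split=> //; first exact: W_mono (leqnSn m) Wu.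
by rewrite (iter_raiseS _ _ xm) subSn // iterS eu linear0 linear0 mul0rn addr0.
Qed.

(** With d = m - 2k, this is the lowest weight vector of the component of weight d - 1 when u is
    tensored with the new two-dimensional factor. The coefficients are forced by [phi], which sends
    [ins x u] to u and [raise m u] to d u. *)
Lemma lowest_weight_down m k u x : val x = m -> (k.*2 < m)%N -> lowest_weight m k u ->
  lowest_weight m.+1 k.+1 (ins x u *+ (m - k.*2) - raise m u).
Proof.
move=> xm lt_km [Wu phiu eu].
have le_mn : (m <= n)%N by rewrite -xm ltnW ?ltn_ord.
have xu : avoids x u by apply: avoids_W Wu _; rewrite xm.
split.
- rewrite rpredB ?rpredMn //; first by rewrite ins_W ?xm // (W_mono (leqnSn m)).
  exact: (W_mono (leqnSn m)) (raise_W Wu).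
- rewrite linearB linearMn /= phi_ins // phiu linear0 add0r.
  rewrite (phi_raise le_mn Wu) phiu linear0 add0r -natrB; last exact: ltnW.
  by rewrite scaler_nat subrr.
have [b def_b] : exists b, (m - k.*2 = b.+1)%N.
  by exists (m - k.*2).-1; rewrite prednK ?subn_gt0.
rewrite doubleS subSS subnS def_b succnK.
rewrite def_b in eu *.
(* The exponent is now d = b + 1. The terms with [ins x] cancel, and the term without it is
   [raise m] applied b + 2 times to u, already zero. *)
rewrite iter_raiseB iter_raiseMn !(iter_raiseS _ _ xm) -!ins_iter_raise insK mul0rn addr0.
by rewrite -!iterSr eu add0r subrr.
Qed.

End Dot.

(** * Polytabloids as products over columns *)

Section Columns.

Variables (F : fieldType) (n : nat).
Local Notation V := (subsetMod F n).
Local Notation phi := (phi F n).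
Local Notation W := (prefixSpace F n).
Implicit Types (x y : 'I_n) (A B : {set 'I_n}) (u v w : V) (m k j : nat).
Implicit Types (s : 'S_n) (c : 'I_n * 'I_n) (r : seq ('I_n * 'I_n)).

(** The antisymmetric factor of a column (top, bottom): it spans the sl2-invariants in the tensor
    product of the two factors. *)
Definition singlet c v : V := ins c.2 v - ins c.1 v.

Fact singlet_is_linear c : linear (singlet c).
Proof.
move=> a u v; rewrite /singlet (linearP (ins c.2)) (linearP (ins c.1)) /=.
by rewrite scalerBr opprD addrACA.
Qed.
HB.instance Definition _ c :=
  GRing.isLinear.Build F V V _ (singlet c) (singlet_is_linear c).

Definition polycol r : V := foldr singlet (subsetVec F set0) r.

Definition entries r := unzip1 r ++ unzip2 r.

Lemma mem_entries_cons x c r :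
  (x \in entries (c :: r)) = [|| x == c.1, x == c.2 | x \in entries r].
Proof. by rewrite /entries /= inE !mem_cat inE; congr (_ || _); apply: orbCA. Qed.

Lemma uniq_entries_cons c r : uniq (entries (c :: r)) =
  [&& c.1 != c.2, c.1 \notin entries r, c.2 \notin entries r & uniq (entries r)].
Proof.
have catCA := permEl (perm_catCA (unzip1 r) [:: c.2] (unzip2 r)).
rewrite /entries /= (perm_mem catCA) (perm_uniq catCA) /= inE negb_or.
by rewrite -!andbA.
Qed.

Lemma singletC c d v : singlet c (singlet d v) = singlet d (singlet c v).
Proof.
rewrite /singlet 2!(linearB (ins _)) 2!(linearB (ins _)) /= !(insC d.1) !(insC d.2).
by rewrite !opprB addrACA [RHS]addrACA; congr (_ + _); apply: addrC.
Qed.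

(** Column factors commute. This is needed because column stabilizers list the columns in an
    unspecified order, and because a new column is appended at the end. *)
Lemma polycol_perm r r' : perm_eq r r' -> polycol r = polycol r'.
Proof.
have pull c q : c \in q -> polycol q = singlet c (polycol (rem c q)).
  elim: q => //= d q IHq; rewrite inE eq_sym; case: eqP => [->//|_ /= /IHq->].
  exact: singletC.
elim: r r' => [|c r IHr] r' prr'; first by case: r' prr' => // d r' /perm_size.
have cr' : c \in r' by rewrite -(perm_mem prr') mem_head.
rewrite (pull c r') //=; congr singlet; apply: IHr.
by rewrite -(perm_cons c) (perm_trans prr') // perm_to_rem.
Qed.

Lemma avoids_polycol r x : x \notin entries r -> avoids x (polycol r).
Proof.
elim: r => [_ A xA|c r IHr] /=.
  by rewrite subsetVecE; case: eqP xA => // ->; rewrite inE.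
rewrite mem_entries_cons !negb_or => /and3P[xc1 xc2 /IHr xr].
by apply: avoidsB; apply: avoids_ins.
Qed.

Lemma polycol_W m r :
  (forall x, x \in entries r -> (x < m)%N) -> polycol r \in W m (size r).
Proof.
elim: r => [_|c r IHr mr] /=.
  apply/memW=> A; rewrite subsetVecE; case: (A =P set0) => [->|_]; last by rewrite eqxx.
  by rewrite cards0; split=> // x; rewrite inE.
have Wr : polycol r \in W m (size r).
  by apply: IHr => x xr; apply: mr; rewrite mem_entries_cons xr !orbT.
by rewrite rpredB // ins_W // mr // mem_entries_cons eqxx ?orbT.
Qed.

(** In each column, removing the top point and removing the bottom point leave the same vector with
    opposite signs. *)
Lemma phi_polycol r : uniq (entries r) -> phi (polycol r) = 0.
Proof.
elim: r => [_|c r IHr].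
  by rewrite (phi_W0 (m := 0)) //; apply: (@polycol_W 0 [::]).
rewrite uniq_entries_cons => /and4P[_ /avoids_polycol c1r /avoids_polycol c2r /IHr phir].
rewrite /= linearB /= !phi_ins // phir !linear0 !add0r.
exact: subrr.
Qed.

Lemma polycol_unzip2 r : uniq (entries r) -> polycol r [set x in unzip2 r] = 1.
Proof.
elim: r => [_|c r IHr].
  by rewrite /= subsetVecE; case: eqP => // /setP[]; split=> x; rewrite !inE.
rewrite uniq_entries_cons => /and4P[c12 c1r c2r /IHr <-].
move: c1r c2r; rewrite !mem_cat !negb_or => /andP[_ c1r] /andP[_ c2r].
rewrite !ffunE !inE eqxx /= (negPf c12) (negPf c1r) /= subr0.
congr (polycol r _); apply/setP=> x; rewrite !inE.
by case: eqP => // ->; rewrite (negPf c2r).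
Qed.

Lemma permActE s v A : permAct F s v (s @: A) = v A.
Proof.
rewrite lfunE /= /linExt sum_ffunE (bigD1 A) //= big1 => [|B neqBA].
  by rewrite !ffunE eqxx addr0 /GRing.scale /= mulr1.
rewrite !ffunE; case: eqP => [/imset_inj eAB|_]; last by rewrite scaler0.
by rewrite eAB ?eqxx // in neqBA; apply: perm_inj.
Qed.

Lemma eq_permAct s v u : (forall A, u (s @: A) = v A) -> permAct F s v = u.
Proof.
move=> uv; apply/ffunP=> B; have -> : B = s @: (s^-1%g @: B).
  by rewrite -imset_comp -[LHS]imset_id; apply: eq_imset => x /=; rewrite permKV.
by rewrite permActE uv.
Qed.

Lemma permAct_subsetVec s A : permAct F s (subsetVec F A) = subsetVec F (s @: A).
Proof. by rewrite lfunE /= linExt_subsetVec. Qed.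

Lemma permActM s s' v : permAct F (s * s')%g v = permAct F s' (permAct F s v).
Proof.
apply: eq_permAct => A; rewrite -[in RHS](permActE s) -[in RHS](permActE s').
by congr (permAct F _ _ _); rewrite -imset_comp; apply: eq_imset => x /=; rewrite permM.
Qed.

Lemma permAct1 v : permAct F 1%g v = v.
Proof.
apply: eq_permAct => A; congr (v _); rewrite -[RHS]imset_id.
by apply: eq_imset => x; rewrite perm1.
Qed.

Lemma permAct_ins s x v : permAct F s (ins x v) = ins (s x) (permAct F s v).
Proof.
apply: eq_permAct => A; rewrite !ffunE mem_imset; last exact: perm_inj.
case: ifP => // _; rewrite -(permActE s v (A :\ x)); congr (permAct F _ _ _).
apply/setP=> y; rewrite -(permKV s y) !inE !mem_imset ?inE ?(inj_eq perm_inj) //;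
  exact: perm_inj.
Qed.

Lemma permAct_phi s v : permAct F s (phi v) = phi (permAct F s v).
Proof.
have del_act x : permAct F s (del x v) = del (s x) (permAct F s v).
  apply: eq_permAct => A; rewrite !ffunE mem_imset; last exact: perm_inj.
  case: ifP => // _; rewrite -(permActE s v (x |: A)); congr (permAct F _ _ _).
  by rewrite imsetU1.
rewrite !phiE linear_sum /= [RHS](reindex_inj (@perm_inj _ s)).
by apply: eq_bigr => x _; apply: del_act.
Qed.

Lemma permAct_polycol s r :
  permAct F s (polycol r) = polycol [seq (s c.1, s c.2) | c <- r].
Proof.
elim: r => [|c r IHr] /=; first by rewrite permAct_subsetVec imset0.
by rewrite linearB /= !permAct_ins IHr.
Qed.

Lemma permAct_W s k v : v \in W n k -> permAct F s v \in W n k.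
Proof.
move=> /memW Wv; apply/memW=> B.
have -> : B = s @: (s^-1%g @: B).
  by rewrite -imset_comp -[LHS]imset_id; apply: eq_imset => x /=; rewrite permKV.
rewrite permActE => /Wv[cA _]; split=> [|x _]; last exact: ltn_ord.
by rewrite card_imset //; apply: perm_inj.
Qed.

End Columns.

(** * Signed sums over a column group *)

Section ColumnGroup.

Variables (F : fieldType) (n : nat).
Local Notation V := (subsetMod F n).
Local Notation W := (prefixSpace F n).
Implicit Types (x y : 'I_n) (A B : {set 'I_n}) (u v w : V) (m k j : nat).
Implicit Types (s : 'S_n) (c : 'I_n * 'I_n) (r : seq ('I_n * 'I_n)).

Definition cosinglet c v : V :=
  [ffun A : {set 'I_n} => if (c.1 \in A) || (c.2 \in A) then 0
     else v (c.2 |: A) - v (c.1 |: A)].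

Lemma cosinglet_W k c v : v \in W n k.+1 -> cosinglet c v \in W n k.
Proof.
move=> /memW Wv; apply/memW=> A; rewrite ffunE.
case: ifPn => [|]; first by rewrite eqxx.
rewrite negb_or => /andP[c1A c2A] nz; split=> [|x _]; last exact: ltn_ord.
have [/eqP|] := boolP (v (c.2 |: A) == 0); last first.
  by case/Wv; rewrite cardsU1 c2A add1n => [[->]].
move=> v2; move: nz; rewrite v2 sub0r oppr_eq0 => /Wv[].
by rewrite cardsU1 c1A add1n => [[->]].
Qed.

Lemma dot_singlet c u v : avoids c.1 u -> avoids c.2 u ->
  dot (singlet c u) v = dot u (cosinglet c v).
Proof.
move=> c1u c2u; rewrite dotBl !dot_ins -linearB /=; apply: eq_bigr => A _.
rewrite !ffunE; have [c1A|c1A] := boolP (c.1 \in A); first by rewrite c1u ?mul0r.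
by have [c2A|c2A] := boolP (c.2 \in A); first by rewrite c2u ?mul0r.
Qed.

(** Compared coefficient by coefficient: sets with both or neither of the two points are fixed by
    the transposition and give 0; the other sets are exchanged in pairs. *)
Lemma sub_permAct_tperm c v : c.1 != c.2 ->
  v - permAct F (tperm c.1 c.2) v = singlet c (cosinglet c v).
Proof.
case: c => a b /= neq_ab; apply/ffunP=> A; rewrite !ffunE /= !in_setD1 !eqxx.
rewrite neq_ab (eq_sym b a) neq_ab /=.
have tK B : tperm a b @: (tperm a b @: B) = B.
  by rewrite -imset_comp -[RHS]imset_id; apply: eq_imset => x /=; rewrite tpermK.
have tE B : permAct F (tperm a b) v B = v (tperm a b @: B).
  by rewrite -{1}(tK B) permActE.
have t_out B : a \notin B -> b \notin B -> tperm a b @: B = B.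
  move=> aB bB; rewrite -[RHS]imset_id; apply: eq_in_imset => x xB.
  by rewrite tpermD //; apply: contraTneq xB => <-.
rewrite tE; have [aA|aA] := boolP (a \in A); have [bA|bA] := boolP (b \in A).
- have AE : A = a |: (b |: (A :\ a :\ b)).
    by rewrite setD1K ?setD1K // in_setD1 eq_sym neq_ab.
  rewrite AE !imsetU1 tpermL tpermR t_out ?inE ?eqxx ?andbF //.
  by rewrite setUCA !subrr.
- rewrite sub0r setD1K // opprB; congr (_ - v _).
  rewrite -{1}(setD1K aA) imsetU1 tpermL t_out ?inE ?eqxx //.
  by rewrite negb_and bA orbT.
- rewrite subr0 setD1K //; congr (_ - v _).
  rewrite -{1}(setD1K bA) imsetU1 tpermR t_out ?inE ?eqxx //.
  by rewrite negb_and aA orbT.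
by rewrite t_out // !subrr.
Qed.

Definition colgroup r : {set 'S_n} := (\prod_(c <- r) <[tperm c.1 c.2]>)%g.

Lemma colgroup_cons c r : c.1 != c.2 ->
  colgroup (c :: r) = colgroup r :|: (tperm c.1 c.2 *: colgroup r)%g.
Proof.
move=> neq_c; rewrite /colgroup big_cons cycle2g; last first.
  apply: nt_prime_order => //; first by rewrite expgS expg1 tperm2.
  apply: contraNneq neq_c => /permP/(_ c.1).
  by rewrite tpermL perm1 => ->.
by rewrite mulUg mul1g.
Qed.

Lemma colgroup_fix r s x : uniq (entries r) -> s \in colgroup r ->
  x \notin entries r -> s x = x.
Proof.
elim: r s => [|c r IHr] s.
  by rewrite /colgroup big_nil inE => _ /eqP-> _; rewrite perm1.
rewrite uniq_entries_cons mem_entries_cons !negb_or.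
case/and4P=> neq_c _ _ Ur; rewrite colgroup_cons // inE.
move=> sC /and3P[xc1 xc2 xr]; case/orP: sC => [sr|/lcosetP[s' sr ->]].
  exact: IHr.
by rewrite permM tpermD ?IHr // eq_sym.
Qed.

Definition kappa (C : {set 'S_n}) v : V :=
  \sum_(s in C) (-1) ^+ odd_perm s *: permAct F s v.

(** The group splits into two cosets of [colgroup r], disjoint because [colgroup r] fixes both
    entries of c. The transposition acts first, since permutations compose from left to right. *)
Lemma kappa_cons c r v : uniq (entries (c :: r)) ->
  kappa (colgroup (c :: r)) v
  = kappa (colgroup r) (v - permAct F (tperm c.1 c.2) v).
Proof.
rewrite uniq_entries_cons => /and4P[neq_c c1r c2r Ur].
have dis : [disjoint colgroup r & (tperm c.1 c.2 *: colgroup r)%g].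
  rewrite disjoint_subset; apply/subsetP=> s sr; rewrite !inE.
  apply/negP=> /lcosetP[s' sr' es]; have := colgroup_fix Ur sr c1r.
  rewrite es permM tpermL (colgroup_fix Ur sr' c2r) => /eqP.
  by rewrite eq_sym (negPf neq_c).
rewrite colgroup_cons // /kappa.
rewrite (eq_bigl [in [predU colgroup r & (tperm c.1 c.2 *: colgroup r)%g]]).
  2: by move=> s; rewrite !inE.
rewrite bigU //=.
rewrite -lcosetE /lcoset big_imset /=; last by move=> s s' _ _; apply: mulgI.
rewrite -big_split; apply: eq_bigr => s _ /=.
rewrite odd_permM odd_tperm neq_c permActM linearB /= scalerBr; congr (_ + _).
by case: (odd_perm s); rewrite !(expr0, expr1) ?scaleN1r ?opprK ?scale1r.
Qed.

Lemma kappa_singlet c r v : uniq (entries (c :: r)) ->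
  kappa (colgroup r) (singlet c v) = singlet c (kappa (colgroup r) v).
Proof.
rewrite uniq_entries_cons => /and4P[_ c1r c2r Ur].
rewrite /kappa linear_sum; apply: eq_bigr => s sr /=.
rewrite linearZ /= linearB /= !permAct_ins.
by rewrite !(colgroup_fix Ur sr).
Qed.

(* The signed sum is the product of the factors 1 - (a b), each of which is
   [singlet] after [cosinglet], its adjoint on vectors avoiding a and b. *)
Lemma kappa_colgroup r v : uniq (entries r) -> v \in W n (size r) ->
  kappa (colgroup r) v = dot (polycol F r) v *: polycol F r.
Proof.
elim: r v => [|c r IHr] v Ur Wv.
  rewrite /kappa /colgroup big_nil big_set1 odd_perm1 expr0 scale1r permAct1.
  rewrite dot_subsetVec; apply/ffunP=> A; rewrite !ffunE.
  have [->|nzA] := eqVneq A set0; first by rewrite /GRing.scale /= mulr1.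
  rewrite scaler0; apply/eqP; apply: contraNT nzA => /(memW _ _ _ Wv)[/eqP].
  by rewrite cards_eq0.
move: (Ur); rewrite uniq_entries_cons => /and4P[neq_c c1r c2r Ur'].
rewrite kappa_cons // sub_permAct_tperm // kappa_singlet // IHr ?cosinglet_W //.
by rewrite linearZ /= -dot_singlet //; apply: avoids_polycol.
Qed.

End ColumnGroup.

(** * Polytabloids of tableaux and their permutation *)

Section Tabloids.

Variables (F : fieldType) (n k : nat).
Hypothesis le_2k_n : (2 * k <= n)%N.
Local Notation V := (subsetMod F n).
Local Notation phi := (phi F n).
Local Notation W := (prefixSpace F n).
Implicit Types (t : filling n k) (s : 'S_n) (v : V).

(** [zip] stops at the shorter row, so the top entries with nothing below them are dropped. *)
Definition tabcols t := zip (codom (top t)) (codom (bot t)).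

Let le_k_nk : (k <= n - k)%N. Proof. by rewrite leq_subRL //; lia. Qed.

Let size_le t : (size (codom (bot t)) <= size (codom (top t)))%N.
Proof. by rewrite !size_codom !card_ord. Qed.

Lemma subseq_entries_zip (ts bs : seq 'I_n) :
  subseq (entries (zip ts bs)) (ts ++ bs).
Proof.
apply: cat_subseq; elim: ts bs => [|x ts IHts] [|y bs] //=;
  by rewrite eqxx.
Qed.

Lemma size_tabcols t : size (tabcols t) = k.
Proof. by rewrite size_zip !size_codom !card_ord; apply/minn_idPr. Qed.

Lemma tableau_uniq t : t \in tableau n k -> uniq (codom (top t) ++ codom (bot t)).
Proof.
rewrite inE => /andP[/injectiveP inj_t _].
have injT : injective (top t) by move=> i j /inj_t[].
have injB : injective (bot t) by move=> i j /inj_t[].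
rewrite cat_uniq !map_inj_uniq // -!enumT !enum_uniq andbT; apply/hasPn=> x.
by case/codomP=> j ->; apply/codomP=> -[i /inj_t].
Qed.

Lemma uniq_tabcols t : t \in tableau n k -> uniq (entries (tabcols t)).
Proof. by move/tableau_uniq; apply: subseq_uniq; apply: subseq_entries_zip. Qed.

Lemma map_tabcols s t :
  [seq (s c.1, s c.2) | c <- tabcols t]
  = tabcols ([ffun c => s (t c)] : filling n k).
Proof.
have map_zip (ts bs : seq 'I_n) :
    [seq (s c.1, s c.2) | c <- zip ts bs] = zip (map s ts) (map s bs).
  by elim: ts bs => [|x ts IHts] [|y bs] //=; rewrite IHts.
rewrite /tabcols map_zip; congr zip; rewrite -map_comp;
  by apply: eq_map => j; rewrite /= /top /bot ffunE.
Qed.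

(** The columns come in the order in which pairs of indices are enumerated, hence only up to
    permutation. *)
Lemma colstabE t :
  exists2 r, colstab t = colgroup r & perm_eq r (tabcols t).
Proof.
pose e := [seq c : 'I_(n - k) * 'I_k <- index_enum ('I_(n - k) * 'I_k)%type | c.1 == c.2 :> nat].
exists [seq (top t c.1, bot t c.2) | c <- e].
  by rewrite /colstab /colgroup big_map big_filter.
(* Without a second row there may be no point to serve as the default value of [nth]. *)
have [k0|k_gt0] := posnP k.
  have -> : e = [::] by case: (e) => [//|[i [j ltjk]] e']; lia.
  by have -> : tabcols t = [::] by apply: size0nil; rewrite size_tabcols.
pose x0 := bot t (Ordinal k_gt0).
pose h j := (nth x0 (codom (top t)) j, nth x0 (codom (bot t)) j).
have -> : [seq (top t c.1, bot t c.2) | c <- e] = map h (map (fun c => val c.2) e).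
  rewrite -map_comp; apply/eq_in_map => -[i j]; rewrite mem_filter /= => /andP[/eqP eij _].
  rewrite /h -{1}eij; congr (_, _).
    by rewrite (nth_map i) ?size_enum_ord // nth_ord_enum.
  by rewrite (nth_map j) ?size_enum_ord // nth_ord_enum.
have -> : tabcols t = map h (iota 0 k).
  apply: (@eq_from_nth _ (x0, x0)) => [|i]; rewrite size_tabcols ?size_map ?size_iota //.
  move=> lt_ik; rewrite (nth_map 0%N) ?size_iota // nth_iota // add0n.
  by rewrite nth_zip_cond -/(tabcols t) size_tabcols lt_ik.
apply: perm_map; apply: uniq_perm; rewrite ?iota_uniq //.
  rewrite map_inj_in_uniq ?filter_uniq ?index_enum_uniq // => -[i j] [i' j'].
  rewrite !mem_filter /= => /andP[/eqP eij _] /andP[/eqP eij' _] /val_inj ejj.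
  by rewrite ejj; congr (_, _); apply: val_inj; rewrite /= eij eij' ejj.
move=> j; rewrite mem_iota add0n /=; apply/mapP/idP => [[c _ ->]|lt_jk]; first exact: ltn_ord.
exists (Ordinal (leq_trans lt_jk le_k_nk), Ordinal lt_jk) => //.
by rewrite mem_filter /= eqxx mem_index_enum.
Qed.

Lemma tabsetE t : tabset t = [set x in unzip2 (tabcols t)].
Proof.
rewrite unzip2_zip //; apply/setP=> x; rewrite !inE.
by apply/imsetP/codomP=> [[j _ ->]|[j ->]]; exists j.
Qed.

(** The sign lemma of James: signed column sums are multiples of the polytabloid, with the pairing
    as coefficient. *)
Lemma kappa_colstab t v : t \in tableau n k -> v \in W n k ->
  kappa (colstab t) v = dot (polycol F (tabcols t)) v *: polycol F (tabcols t).
Proof.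
move=> /uniq_tabcols Ut Wv; have [r -> pr] := colstabE t.
rewrite -(polycol_perm F pr) kappa_colgroup //; last by rewrite (perm_size pr) size_tabcols.
rewrite -(perm_uniq (_ : perm_eq (entries (tabcols t)) _)) //.
by rewrite perm_sym; apply: perm_cat; apply: perm_map.
Qed.

Lemma polytabloidE t : t \in tableau n k -> polytabloid F t = polycol F (tabcols t).
Proof.
move=> tabt; have Ut := uniq_tabcols tabt.
rewrite /polytabloid -/(kappa _ _) kappa_colstab //.
  by rewrite dotC dot_subsetVec tabsetE polycol_unzip2 // scale1r.
apply/memW=> A; rewrite subsetVecE; case: (A =P tabset t) => [-> _|_]; last by rewrite eqxx.
split=> [|x _]; last exact: ltn_ord.
rewrite tabsetE cardsE (card_uniqP _) ?size_map ?size_tabcols //.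
by move: Ut; rewrite cat_uniq => /and3P[].
Qed.

Lemma polytabloid_W t : t \in tableau n k -> polytabloid F t \in W n k.
Proof.
move=> tabt; rewrite polytabloidE // -[k in W n k](size_tabcols t).
by apply: polycol_W => x _; apply: ltn_ord.
Qed.

Lemma phi_polytabloid t : t \in tableau n k -> phi (polytabloid F t) = 0.
Proof. by move=> tabt; rewrite polytabloidE // phi_polycol ?uniq_tabcols. Qed.

Lemma permAct_polytabloid s t : t \in tableau n k ->
  exists2 t', t' \in tableau n k & permAct F s (polytabloid F t) = polytabloid F t'.
Proof.
move=> tabt; pose t' : filling n k := [ffun c => s (t c)].
have tabt' : t' \in tableau n k.
  move: tabt; rewrite !inE => /andP[/injectiveP inj_t /forallP onto].
  apply/andP; split; first by apply/injectiveP=> c d; rewrite !ffunE => /perm_inj/inj_t.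
  apply/forallP=> x; have /codomP[c ec] := onto (s^-1%g x).
  by apply/codomP; exists c; rewrite ffunE -ec permKV.
exists t' => //; rewrite !polytabloidE // permAct_polycol; congr polycol.
exact: map_tabcols.
Qed.

Lemma tableau_transitive t t' : t \in tableau n k -> t' \in tableau n k ->
  exists s, permAct F s (polytabloid F t) = polytabloid F t'.
Proof.
move=> tabt tabt'; move: (tabt) (tabt'); rewrite !inE.
case/andP=> /injectiveP inj_t /forallP onto /andP[/injectiveP inj_t' _].
pose f x := t' (iinv (onto x)).
have fE c : f (t c) = t' c by congr (t' _); apply: inj_t; rewrite f_iinv.
have inj_f : injective f.
  move=> x y; have /codomP[c ->] := onto x; have /codomP[d ->] := onto y.
  by rewrite !fE => /inj_t'->.
exists (perm inj_f); rewrite !polytabloidE // permAct_polycol; congr polycol.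
have -> : t' = [ffun c => perm inj_f (t c)].
  by apply/ffunP=> c; rewrite ffunE permE fE.
exact: map_tabcols.
Qed.

End Tabloids.

(** * p-standard tableaux as walks in a strip *)

Section Walks.

Variables (p n' : nat).
Local Notation n := n'.+1.
Local Notation T := (seq 'I_n * seq 'I_n)%type.
Implicit Types (m k j : nat) (x y : 'I_n) (t : T).

(** Points are placed in increasing order; a point in the top row moves m - 2k up, one in the bottom
    row moves it down. The test keeps the walk between 0 and p - 2 at all times. *)
Fixpoint walks m k : seq T :=
  match m with
  | 0 => if k == 0%N then [:: ([::], [::])] else [::]
  | m'.+1 =>
    if (k.*2 <= m'.+1 <= k.*2 + (p - 2))%N then
      [seq (rcons t.1 (inord m'), t.2) | t <- walks m' k] ++
      (if k is k'.+1 then [seq (t.1, rcons t.2 (inord m')) | t <- walks m' k']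
       else [::])
    else [::]
  end.

Local Notation ltI := (fun x y : 'I_n => (x < y)%N).

(* Rows of a p-standard tableau with entries 0, ..., m - 1. The upper bound on m
   is the p-standard condition for the bottom entries that are still to come. *)
Definition pstd m k t :=
  [/\ size t.2 = k, (k.*2 <= m <= k.*2 + (p - 2))%N,
      uniq (t.1 ++ t.2) & forall x, (x \in t.1 ++ t.2) = (x < m)%N]
  /\ [/\ pairwise ltI t.1, pairwise ltI t.2,
      forall j, (j < k)%N -> (nth ord0 t.1 j < nth ord0 t.2 j)%N &
      forall j, (j < k)%N -> (j + (p - 2) < size t.1)%N ->
        (nth ord0 t.2 j < nth ord0 t.1 (j + (p - 2)))%N].

Lemma pstd_size m k t : (m <= n)%N -> pstd m k t -> (size t.1 + k = m)%N.
Proof.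
move=> le_mn [[<- _ Ut mt] _]; rewrite -size_cat -(card_uniqP Ut).
rewrite -[RHS](card_ltn_ord le_mn); apply: eq_card => x.
by rewrite [LHS]mt.
Qed.

Lemma pstd_lt1 m k t j : pstd m k t -> (j < size t.1)%N -> (nth ord0 t.1 j < m)%N.
Proof. by move=> [[_ _ _ mt] _] lt_j; rewrite -mt mem_cat mem_nth. Qed.

Lemma pstd_lt2 m k t j : pstd m k t -> (j < k)%N -> (nth ord0 t.2 j < m)%N.
Proof. by move=> [[sz _ _ mt] _] lt_j; rewrite -mt mem_cat mem_nth ?orbT ?sz. Qed.

Lemma pstd_up m k t x : val x = m -> ((k.*2 <= m.+1 <= k.*2 + (p - 2))%N) ->
  pstd m k t -> pstd m.+1 k (rcons t.1 x, t.2).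
Proof.
move=> xm rg Pt; have le_mn : (m <= n)%N by rewrite -xm ltnW ?ltn_ord.
have st := pstd_size le_mn Pt.
have nx : x \notin t.1 ++ t.2 by case: Pt => -[_ _ _ ->]; rewrite xm ltnn.
case: (Pt) => -[sz rg' Ut mt] [p1 p2 col pcol]; split; split=> //=.
- by rewrite cat_rcons -cat1s uniq_catCA /= nx.
- by move=> y; rewrite cat_rcons mem_cat inE orbCA -mem_cat mt ltnS [RHS]leq_eqVlt -xm.
- rewrite pairwise_rcons p1 andbT; apply/allP=> y yt.
  by rewrite xm -mt mem_cat yt.
- by move=> j lt_jk; rewrite nth_rcons ifT ?col //; lia.
move=> j lt_jk; rewrite size_rcons nth_rcons => lt_j.
(* A new constraint has x as its top entry, and x exceeds all bottom entries. *)
have [lt_jt|ge_j] := ltnP (j + (p - 2)) (size t.1); first exact: pcol.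
rewrite ifT; last by lia.
by rewrite xm; apply: pstd_lt2 lt_jk.
Qed.

Lemma pstd_down m k t x : val x = m -> ((k.+1.*2 <= m.+1)%N) ->
  pstd m k t -> pstd m.+1 k.+1 (t.1, rcons t.2 x).
Proof.
move=> xm rg Pt; have le_mn : (m <= n)%N by rewrite -xm ltnW ?ltn_ord.
have st := pstd_size le_mn Pt.
have nx : x \notin t.1 ++ t.2 by case: Pt => -[_ _ _ ->]; rewrite xm ltnn.
case: (Pt) => -[sz rg' Ut mt] [p1 p2 col pcol]; split; split=> //=.
- by rewrite size_rcons sz.
- by lia.
- by rewrite -rcons_cat rcons_uniq nx.
- by move=> y; rewrite -rcons_cat mem_rcons inE mt ltnS [RHS]leq_eqVlt -xm.
- rewrite pairwise_rcons p2 andbT; apply/allP=> y yt.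
  by rewrite xm -mt mem_cat yt orbT.
- move=> j; rewrite ltnS leq_eqVlt nth_rcons sz => /orP[/eqP->|lt_jk].
    rewrite ltnn eqxx xm; apply: pstd_lt1 Pt _; lia.
  by rewrite lt_jk col.
(* For the new bottom entry the constraint is vacuous: the old upper bound on m leaves no top entry
   in column k + (p - 2). *)
move=> j; rewrite ltnS leq_eqVlt nth_rcons sz => /orP[/eqP->|lt_jk] lt_j; first lia.
by rewrite lt_jk pcol.
Qed.

Lemma pairwise_last (r : seq 'I_n) x : pairwise ltI r ->
  (forall y, y \in r -> (y <= x)%N) -> x \in r -> exists s, r = rcons s x.
Proof.
case/lastP: r => [//|s y]; rewrite pairwise_rcons => /andP[/allP lt_y _] le_x.
rewrite mem_rcons inE => /orP[/eqP->|/lt_y lt_xy]; first by exists s.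
by have := le_x y; rewrite mem_rcons mem_head leqNgt lt_xy => /(_ isT).
Qed.

(** The largest entry ends one of the rows. What has to be proved is that the walk was in the strip
    before this entry: the column condition gives the lower bound, and the p-standard condition the
    upper one. *)
Lemma pstd_inv m k t x : val x = m -> pstd m.+1 k t ->
  (exists2 s, pstd m k s & t = (rcons s.1 x, s.2)) \/
  (exists k' s, [/\ k = k'.+1, pstd m k' s & t = (s.1, rcons s.2 x)]).
Proof.
move=> xm Pt; have lt_mn : (m < n)%N by rewrite -xm ltn_ord.
have st := pstd_size lt_mn Pt.
case: (Pt) => -[sz rg Ut mt] [p1 p2 col pcol].
have: x \in t.1 ++ t.2 by rewrite mt xm.
have le_x y : y \in t.1 ++ t.2 -> (y <= x)%N by rewrite mt xm ltnS.
rewrite mem_cat => /orP[xt|xt]; [left|right].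
  have [y yt|s1 e1] := pairwise_last p1 _ xt; first by rewrite le_x // mem_cat yt.
  exists (s1, t.2); last by rewrite -e1; case: (t).
  rewrite e1 size_rcons in st pcol.
  have nthE j : (j < size s1)%N -> nth ord0 t.1 j = nth ord0 s1 j.
    by rewrite e1 nth_rcons => ->.
  (* Otherwise the column that ends in x would have a bottom entry larger than x. *)
  have le_ks1 : (k <= size s1)%N.
    rewrite leqNgt; apply/negP=> lt_s1k; have := col (size s1) lt_s1k.
    have := pstd_lt2 Pt lt_s1k; rewrite e1 nth_rcons ltnn eqxx xm; lia.
  have nx : x \notin s1 ++ t.2.
    by move: Ut; rewrite e1 cat_rcons -cat1s uniq_catCA /= => /andP[].
  split; split=> //=; try lia.
  - by move: Ut; rewrite e1 cat_rcons -cat1s uniq_catCA /= => /andP[].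
  - move=> y; have := mt y; rewrite e1 cat_rcons mem_cat inE orbCA -mem_cat.
    rewrite ltnS leq_eqVlt -xm -val_eqE; case: eqP => [/val_inj->|//].
    by rewrite ltnn (negPf nx).
  - by move: p1; rewrite e1 pairwise_rcons => /andP[].
  - by move=> j lt_jk; rewrite -nthE ?col //; lia.
  move=> j lt_jk lt_j; rewrite -nthE // e1 pcol //; lia.
have [y yt|s2 e2] := pairwise_last p2 _ xt; first by rewrite le_x // mem_cat yt orbT.
rewrite e2 size_rcons in sz.
exists (size s2), (t.1, s2); split=> //; last by rewrite -e2; case: (t).
have nthE j : (j < size s2)%N -> nth ord0 t.2 j = nth ord0 s2 j.
  by rewrite e2 nth_rcons => ->.
have last2 : nth ord0 t.2 (size s2) = x by rewrite e2 nth_rcons ltnn eqxx.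
have lt_s2k : (size s2 < k)%N by rewrite -sz.
(* Otherwise the p-standard condition would require a top entry larger than x. *)
have lt_t1 : (size t.1 <= size s2 + (p - 2))%N.
  rewrite leqNgt; apply/negP=> lt_t1; have := pcol _ lt_s2k lt_t1.
  have := pstd_lt1 Pt lt_t1; rewrite last2 xm; lia.
have nx : x \notin t.1 ++ s2.
  by move: Ut; rewrite e2 -rcons_cat rcons_uniq => /andP[].
split; split=> //=; try lia.
- by move: Ut; rewrite e2 -rcons_cat rcons_uniq => /andP[].
- move=> y; have := mt y; rewrite e2 -rcons_cat mem_rcons inE.
  rewrite ltnS leq_eqVlt -xm -val_eqE; case: eqP => [/val_inj->|//].
  by rewrite ltnn (negPf nx).
- by move: p2; rewrite e2 pairwise_rcons => /andP[].
- by move=> j lt_js; rewrite -nthE ?col //; lia.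
by move=> j lt_js lt_j; rewrite -nthE ?pcol //; lia.
Qed.

Lemma walksP m k t : (m <= n)%N -> reflect (pstd m k t) (t \in walks m k).
Proof.
elim: m k t => [|m IHm] k t le_mn.
  apply: (iffP idP) => /=.
    case: eqP => // ->; rewrite inE => /eqP-> /=; split; split=> //.
  case: t => [[|x t1] [|y t2]] /= [[/= <- _ _ mt] _] //.
  by have := mt x; rewrite mem_head.
have xm : val (inord m : 'I_n) = m by rewrite /= inordK.
apply: (iffP idP) => [/=|Pt].
  case: ifP => // rg; rewrite mem_cat => /orP[/mapP[s /IHm-/(_ (ltnW le_mn)) Ps ->]|].
    exact: pstd_up.
  case: k rg => [//|k] /andP[rg _] /mapP[s /IHm-/(_ (ltnW le_mn)) Ps ->].
  exact: pstd_down.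
case: (Pt) => -[_ /= -> _ _] _; rewrite mem_cat.
have [[s Ps ->]|[k' [s [-> Ps ->]]]] := pstd_inv xm Pt.
  by apply/orP; left; apply/mapP; exists s => //; apply/IHm => //; apply: ltnW.
by apply/orP; right; apply/mapP; exists s => //; apply/IHm => //; apply: ltnW.
Qed.

Lemma walks_uniq m k : (m <= n)%N -> uniq (walks m k).
Proof.
elim: m k => [|m IHm] k le_mn /=; first by case: ifP.
case: ifP => // _; rewrite cat_uniq map_inj_uniq ?IHm ?(ltnW le_mn) //=; last first.
  by move=> [a b] [c d] [/eqP]; rewrite eqseq_rcons eqxx andbT => /eqP-> ->.
case: k => [|k] //=; rewrite map_inj_uniq ?IHm ?(ltnW le_mn) ?andbT //; last first.
  by move=> [a b] [c d] [-> /eqP]; rewrite eqseq_rcons eqxx andbT => /eqP->.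
apply/hasPn=> _ /mapP[s /(walksP _ _ (ltnW le_mn)) Ps ->].
apply/mapP=> -[r _ [e1 _]]; case: Ps => -[_ _ _ mt] _.
have := mt (inord m); rewrite e1 mem_cat mem_rcons mem_head inordK ?ltnn // ltnW.
Qed.

(** For p > 2 the strip contains both 0 and 1, so a walk can be traced backwards: undo an up step
    unless m + 1 = 2k, and then undo a down step. *)
Lemma walks_neq_nil m k : (2 < p)%N -> (k.*2 <= m <= k.*2 + (p - 2))%N ->
  walks m k != [::].
Proof.
move=> p_gt2; elim: m k => [|m IHm] k rg.
  by have -> : k = 0%N by lia.
rewrite /= rg; have [le_km|lt_mk] := leqP k.*2 m.
  have: walks m k != [::] by apply: IHm; lia.
  by case: (walks m k).
case: k rg lt_mk => [//|k] rg lt_mk.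
have: walks m k != [::] by apply: IHm; lia.
by case: (walks m k) => // t r _; case: (map _ _).
Qed.

End Walks.

(** * Spanning and independence, by induction on the number of points *)

Section Basis.

Variables (F : fieldType) (p n' : nat).
Hypothesis charF : p \in [pchar F].
Local Notation n := n'.+1.
Local Notation T := (seq 'I_n * seq 'I_n)%type.
Local Notation V := (subsetMod F n).
Local Notation phi := (phi F n).
Local Notation W := (prefixSpace F n).
Local Notation walks := (walks p n').
Implicit Types (m k j : nat) (x y : 'I_n) (t : T) (u v w z : V).

Definition polyrows t : V := polycol F (zip t.1 t.2).

Let p_gt1 : (1 < p)%N.
Proof. exact/prime_gt1/(pcharf_prime charF). Qed.

Lemma pstd_entries m k t : pstd p m k t ->
  uniq (entries (zip t.1 t.2)) /\ forall x, x \in entries (zip t.1 t.2) -> (x < m)%N.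
Proof.
case=> -[_ _ Ut mt] _; have sub := subseq_entries_zip t.1 t.2; split.
  exact: subseq_uniq sub Ut.
by move=> x /(mem_subseq sub); rewrite mt.
Qed.

Lemma polyrows_W m k t : (m <= n)%N -> pstd p m k t -> polyrows t \in W m k.
Proof.
move=> le_mn Pt; have [_ mt] := pstd_entries Pt.
have := polycol_W F mt; rewrite size_zip.
case: (Pt) => -[sz rg _ _] _; have := pstd_size le_mn Pt.
by rewrite sz => st; rewrite (minn_idPr _) //; lia.
Qed.

Lemma phi_polyrows m k t : pstd p m k t -> phi (polyrows t) = 0.
Proof. by case/pstd_entries=> Ut _; apply: phi_polycol. Qed.

Lemma polyrows_up m k t x : (m <= n)%N -> pstd p m k t ->
  polyrows (rcons t.1 x, t.2) = polyrows t.
Proof.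
move=> le_mn Pt; rewrite /polyrows /=; congr polycol.
have : (size t.2 <= size t.1)%N.
  by case: (Pt) => -[-> rg _ _] _; have := pstd_size le_mn Pt; lia.
by elim: (t.1) (t.2) => [|y ts IH] [|b bs] //= /IH->.
Qed.

(** The new point closes the column of the first top entry with nothing below it, here a. *)
Lemma polyrows_down m k t x : val x = m -> (k.+1.*2 <= m.+1)%N -> pstd p m k t ->
  exists a : 'I_n, [/\ (a < m)%N, avoids a (polyrows t) &
    polyrows (t.1, rcons t.2 x) = singlet (a, x) (polyrows t)].
Proof.
move=> xm rg Pt; have le_mn : (m <= n)%N by rewrite -xm ltnW ?ltn_ord.
have lt_sz : (size t.2 < size t.1)%N.
  by case: (Pt) => -[-> _ _ _] _; have := pstd_size le_mn Pt; lia.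
pose a := nth ord0 t.1 (size t.2).
have zipE : zip t.1 (rcons t.2 x) = rcons (zip t.1 t.2) (a, x).
  rewrite /a; elim: (t.1) (t.2) lt_sz => [|y ts IH] [|b bs] //=.
    by case: ts {IH}.
  by move=> /IH->.
have perm_r : perm_eq (rcons (zip t.1 t.2) (a, x)) ((a, x) :: zip t.1 t.2).
  by rewrite perm_rcons.
exists a; split; first exact: pstd_lt1 Pt _.
  have [+ _] := pstd_entries (pstd_down xm rg Pt); rewrite /= zipE.
  have -> : uniq (entries (rcons (zip t.1 t.2) (a, x)))
            = uniq (entries ((a, x) :: zip t.1 t.2)).
    by apply: perm_uniq; apply: perm_cat; apply: perm_map.
  by rewrite uniq_entries_cons => /and4P[_ /(avoids_polycol F)].
by rewrite /polyrows /= zipE (polycol_perm F perm_r).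
Qed.

Lemma span_walks_sub m k v : (m <= n)%N ->
  v \in <<map polyrows (walks m k)>>%VS -> v \in W m k /\ phi v = 0.
Proof.
move=> le_mn; pose P v := v \in W m k /\ phi v = 0.
apply: (span_ind (P := P)) => [|a _ u /mapP[t /(walksP _ _ _ le_mn) Pt ->] [Wu phiu]].
  by rewrite /P linear0; split=> //; apply: mem0v.
rewrite /P rpredD ?rpredZ ?(polyrows_W le_mn Pt) //.
by rewrite linearP /= (phi_polyrows Pt) phiu scaler0 addr0.
Qed.

Lemma span_walks_up m k v : (m < n)%N -> (k.*2 <= m.+1 <= k.*2 + (p - 2))%N ->
  v \in <<map polyrows (walks m k)>>%VS -> v \in <<map polyrows (walks m.+1 k)>>%VS.
Proof.
move=> lt_mn rg; apply: subvP; apply: sub_span => _ /mapP[t tw ->].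
have Pt := walksP _ _ _ (ltnW lt_mn) tw.
rewrite -(polyrows_up (inord m) (ltnW lt_mn) Pt); apply: map_f.
by rewrite /= rg mem_cat; apply/orP; left; apply/mapP; exists t.
Qed.

(** Each lifted polytabloid is [ins x] of the old one minus a vector avoiding x; w gathers these
    corrections. *)
Lemma span_walks_down m k v x : val x = m ->
    (k.+1.*2 <= m.+1 <= k.+1.*2 + (p - 2))%N ->
    v \in <<map polyrows (walks m k)>>%VS ->
  exists2 w, w \in W m k.+1 & ins x v + w \in <<map polyrows (walks m.+1 k.+1)>>%VS.
Proof.
move=> xm rg; have lt_mn : (m < n)%N by rewrite -xm ltn_ord.
have le_mn := ltnW lt_mn; have /andP[rg1 _] := rg.
pose P v := exists2 w, w \in W m k.+1 & ins x v + w \in <<map polyrows (walks m.+1 k.+1)>>%VS.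
apply: (span_ind (P := P)) => [|c _ u /mapP[t tw ->] [w Ww sw]].
  by exists 0; rewrite ?linear0 ?addr0 ?mem0v.
have Pt := walksP _ _ _ le_mn tw.
have [a [lt_am _ eqd]] := polyrows_down xm rg1 Pt.
exists (w - c *: ins a (polyrows t)).
  by rewrite rpredB // rpredZ // ins_W // polyrows_W.
have -> : ins x (c *: polyrows t + u) + (w - c *: ins a (polyrows t))
    = c *: polyrows (t.1, rcons t.2 x) + (ins x u + w).
  rewrite eqd /singlet /= linearP scalerBr -!addrA; congr (_ + _).
  by rewrite addrC -addrA addrC addrA.
rewrite rpredD // rpredZ // memv_span // map_f //= rg mem_cat; apply/orP; right.
by apply/mapP; exists t => //; rewrite -xm inord_val.
Qed.

(** The bounds reach one step beyond the strip on both sides, so that the induction hypothesis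
    applies to both predecessors of a point of the strip. *)
Lemma kernel_spanned m k z : (m <= n)%N -> (k.*2 <= m.+1)%N ->
    (m <= k.*2 + p.-1)%N -> z \in W m k -> phi z = 0 ->
  exists2 w, w \in W m (k + p.-1) &
    z - iter p.-1 phi w \in <<map polyrows (walks m k)>>%VS.
Proof.
have [q def_p] : exists q, p = q.+2 by exists p.-2; lia.
elim: m k z => [|m IHm] k z le_mn le_km le_mk Wz phiz.
  have k0 : k = 0%N by lia.
  rewrite k0 in Wz *; exists 0; first exact: mem0v.
  rewrite (linear0 (iter _ phi)) subr0 /=.
  have -> : z = z set0 *: polyrows ([::], [::]).
    apply/ffunP=> A; rewrite !ffunE; case: eqP => [->|/eqP nzA].
      by rewrite /GRing.scale /= mulr1.
    rewrite scaler0; apply/eqP; apply: contraNT nzA => /(memW _ _ _ Wz)[/eqP].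
    by rewrite cards_eq0.
  by rewrite rpredZ // memv_span // mem_head.
(* Outside the strip [walks] is empty, so z itself must lie in the image. *)
have [rg|nrg] := boolP (k.*2 <= m.+1 <= k.*2 + (p - 2))%N; last first.
  have [|w Ww ->] := kernel_sub_image charF le_mn _ Wz phiz.
    have [-> //|->] : m.+2 = k.*2 \/ m.+2 = (k.*2 + p)%N by lia.
    by rewrite natrD (pcharf0 charF) addr0.
  by exists w; rewrite ?subrr ?mem0v.
pose x : 'I_n := inord m; have xm : val x = m by rewrite /= inordK.
have le_mn' := ltnW le_mn.
case: k le_km le_mk Wz phiz rg => [|k] le_km le_mk Wz phiz rg.
  have Wz' := split_last xm Wz; rewrite (del_W0 x Wz) linear0 subr0 in Wz'.
  have [||w Ww sw] := IHm 0%N z le_mn' _ _ Wz' phiz; try lia.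
  by exists w; [apply: W_mono Ww | apply: span_walks_up].
set y := del x z; have Wy : y \in W m k by apply: del_last_W Wz.
have phiy : phi y = 0 by rewrite /y phi_del phiz linear0.
have Wx0 : z - ins x y \in W m k.+1 := split_last xm Wz.
have [||w Ww sy] := IHm k y le_mn' _ _ Wy phiy; try lia.
set y' := y - _ in sy; have [_ phiy'] := span_walks_sub le_mn' sy.
have phiw : iter p phi w = 0.
  move: phiy'; rewrite /y' linearB /= phiy sub0r -iterS prednK ?(ltnW p_gt1) //.
  by move/eqP; rewrite oppr_eq0 => /eqP.
have [x' Wx' sx'] := span_walks_down xm rg sy.
have xw : avoids x w by apply: avoids_W Ww _; rewrite xm.
(* By [iter_phi_ins], the last term is [ins x] of y - y' plus a multiple of [phi^(p-2) w]. All terms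
   with x therefore cancel in z1. *)
pose z1 := z - (ins x y' + x') - iter p.-1 phi (ins x w).
have Wz1 : z1 \in W m k.+1.
  have -> : z1 = z - ins x y - x' - iter q phi w *+ q.+1.
    rewrite /z1 /y' linearB def_p iter_phi_ins // -addrA -opprD (addrAC (ins x y)).
    by rewrite subrKA !opprD !addrA.
  apply: rpredB; first exact: rpredB.
  by apply: rpredMn; apply: iter_phi_W; rewrite addSnnS; move: Ww; rewrite def_p.
have phiz1 : phi z1 = 0.
  have [_ phis] := span_walks_sub le_mn sx'.
  rewrite /z1 2!(linearB phi) /= phiz phis subr0 sub0r -iterS prednK ?(ltnW p_gt1) //.
  (* Applying [phi] p times to [ins x w] leaves p times [phi^(p-1) w], zero in characteristic p. *)
  rewrite -(prednK (ltnW p_gt1)) iter_phi_ins // prednK ?(ltnW p_gt1) //.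
  by rewrite phiw linear0 add0r -scaler_nat (pcharf0 charF) scale0r oppr0.
have [||w1 Ww1 sw1] := IHm k.+1 z1 le_mn' _ _ Wz1 phiz1; try lia.
exists (ins x w + w1).
  apply: rpredD; last exact: W_mono (leqnSn m) Ww1.
  by rewrite addSn ins_W ?xm // (W_mono (leqnSn m) Ww).
have -> : z - iter p.-1 phi (ins x w + w1)
    = (z1 - iter p.-1 phi w1) + (ins x y' + x').
  by rewrite iter_phiD /z1 -(addrA (z - _)) -opprD addrAC subrK.
by rewrite rpredD // span_walks_up.
Qed.

(** Independence is proved modulo the vectors orthogonal to all lowest weight vectors: this stronger
    form is what [lowest_weight_up] and [lowest_weight_down] carry through the induction. *)
Lemma walks_independent m k (c : T -> F) : (m <= n)%N ->
  (forall u, lowest_weight m k u -> dot (\sum_(t <- walks m k) c t *: polyrows t) u = 0) ->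
  forall t, t \in walks m k -> c t = 0.
Proof.
elim: m k c => [|m IHm] k c le_mn ortho.
  move=> t /=; case: eqP ortho => [->|//] /= ortho; rewrite inE => /eqP->.
  have := ortho (subsetVec F set0); rewrite big_seq1 dotZl dot_subsetVec subsetVecE eqxx mulr1.
  have W0 : subsetVec F set0 \in W 0 0 by apply: (@polycol_W F n 0 [::]).
  by apply; split; rewrite ?(phi_W0 W0) //= /raise big1.
pose x : 'I_n := inord m; have xm : val x = m by rewrite /= inordK.
have le_mn' := ltnW le_mn.
move=> t /=; case: ifP => //= rg; rewrite /= rg big_cat /= in ortho.
have {}ortho u : lowest_weight m.+1 k u ->
    \sum_(t <- walks m k) c (rcons t.1 x, t.2) * dot (polyrows t) u +
    \sum_(t <- if k is k'.+1 then [seq (t.1, rcons t.2 x) | t <- walks m k'] else [::])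
       c t * dot (polyrows t) u = 0.
  move/ortho; rewrite dotDl !dot_suml big_map => sum0; rewrite -[RHS]sum0; congr (_ + _).
    rewrite big_seq [RHS]big_seq; apply: eq_bigr => s /(walksP _ _ _ le_mn') Ps.
    by rewrite dotZl (polyrows_up _ le_mn' Ps).
  by apply: eq_bigr => s _; rewrite dotZl.
(* Testing against vectors built from ins x first isolates the tableaux
   whose last entry x lies in the bottom row. *)
have down0 s : s \in (if k is k'.+1 then [seq (t.1, rcons t.2 x) | t <- walks m k'] else [::]) ->
    c s = 0.
  case: k rg ortho => [//|k] rg ortho /mapP[r rw ->].
  have [[_ rgr _ _] _] := walksP _ _ _ le_mn' rw.
  pose c' (s : T) := c (s.1, rcons s.2 x); set d := (m - k.*2)%N.
  (* The strip gives d <= p - 2. *)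
  have nz_d : d.+1%:R != 0 :> F by rewrite -(dvdn_pcharf charF) gtnNdvd // /d; lia.
  apply: (IHm k c' le_mn') rw => u Tu; have [Wu phiu _] := Tu.
  have lt_km : (k.*2 < m)%N by lia.
  have xu : avoids x u by apply: avoids_W Wu _; rewrite xm.
  have := ortho _ (lowest_weight_down xm lt_km Tu); rewrite big_map -/d.
  (* Polytabloids without x pair to zero with the test vector: they avoid x, and [phi], the adjoint
     of [raise m], kills them. *)
  rewrite big_seq big1 ?add0r => [|q /(walksP _ _ _ le_mn') Pt]; last first.
    have WE := polyrows_W le_mn' Pt.
    rewrite linearB linearMn /= dotC dot_ins_avoids; last by apply: avoids_W WE _; rewrite xm.
    by rewrite -(dot_phi _ WE) (phi_polyrows Pt) dotC linear0 mul0rn subrr mulr0.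
  (* For a tableau with x in the bottom row, the [ins x] parts contribute d times the pairing of the
     smaller vectors, and the pairing of [ins a] with [raise m u] contributes it once more. *)
  rewrite dot_suml => sum0; apply: (mulfI nz_d); rewrite mulr0 -[RHS]sum0 mulr_sumr.
  rewrite big_seq [RHS]big_seq; apply: eq_bigr => q /(walksP _ _ _ le_mn') Pt.
  have WE := polyrows_W le_mn' Pt; rewrite dotZl mulrCA; congr (_ * _).
  have [|a [lt_am aE ->]] := polyrows_down xm _ Pt; first by lia.
  have Wa : ins a (polyrows q) \in W m k.+1 by rewrite ins_W.
  rewrite dotBl /= !(linearB (dot _)) !(linearMn (dot _)) /=.
  rewrite dot_ins del_ins // (dot_ins_avoids _ (avoids_W (raise_W Wu) _)) ?xm //.
  rewrite (dotC (ins a _)) (dot_ins_avoids _ (avoids_W Wa _)) ?xm //.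
  rewrite -(dot_phi _ Wa) phi_ins // (phi_polyrows Pt) (linear0 (ins a)) add0r.
  by rewrite mul0rn subr0 sub0r opprK -mulrSr mulr_natl.
rewrite mem_cat => /orP[/mapP[s sw ->]|]; last exact: down0.
pose c' (s : T) := c (rcons s.1 x, s.2).
have [[_ rgs _ _] _] := walksP _ _ _ le_mn' sw.
have le_km : (k.*2 <= m)%N by lia.
apply: (IHm k c' le_mn') sw => u Tu.
have := ortho _ (lowest_weight_up xm le_km Tu).
rewrite [X in _ + X]big_seq [X in _ + X]big1 ?addr0 => [<-|q /down0->]; last exact: mul0r.
by rewrite dot_suml; apply: eq_bigr => q _; rewrite dotZl.
Qed.

End Basis.

(** * Bases of a subquotient from families of representatives *)

Section FamilyBasis.

Variables (F : fieldType) (vT : vectType F) (T : eqType).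
Implicit Types (f : T -> vT) (L : seq T).

Let sum_cons f t L (c : T -> F) a : t \notin L ->
  \sum_(s <- t :: L) (if s == t then a else c s) *: f s
  = a *: f t + \sum_(s <- L) c s *: f s.
Proof.
move=> tL; rewrite big_cons eqxx; congr (_ + _).
by apply: eq_big_seq => s sL; case: eqP sL tL => // -> ->.
Qed.

Lemma span_map_sum f L v : uniq L -> v \in <<map f L>>%VS ->
  exists c : T -> F, v = \sum_(t <- L) c t *: f t.
Proof.
elim: L v => [|t L IHL] v /=.
  by rewrite span_nil memv0 => _ /eqP->; exists (fun _ => 0); rewrite big_nil.
case/andP=> tL UL; rewrite span_cons => /memv_addP[_ /vlineP[a ->] [u /IHL[]// c -> ->]].
by exists (fun s => if s == t then a else c s); rewrite sum_cons.
Qed.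

Lemma free_map f L : uniq L ->
    (forall c : T -> F, \sum_(t <- L) c t *: f t = 0 -> {in L, forall t, c t = 0}) ->
  free (map f L).
Proof.
elim: L => [|t L IHL] /=; first by rewrite nil_free.
case/andP=> tL UL indep; rewrite free_cons; apply/andP; split.
  apply/negP=> /(span_map_sum UL)[c ft].
  have sum0 : \sum_(s <- t :: L) (if s == t then -1 else c s) *: f s = 0.
    by rewrite sum_cons // -ft scaleN1r addNr.
  have := indep _ sum0 t (mem_head t L); rewrite eqxx => /eqP.
  by rewrite oppr_eq0 oner_eq0.
apply: IHL => // c c0 s sL.
have sum0 : \sum_(r <- t :: L) (if r == t then 0 else c r) *: f r = 0.
  by rewrite sum_cons // c0 scale0r addr0.
have := indep _ sum0 s; rewrite inE sL orbT => /(_ isT).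
by case: eqP sL tL => // -> ->.
Qed.

End FamilyBasis.

Lemma basis_subquot (F : fieldType) (vT : vectType F) (T : eqType)
    (f : T -> vT) (L : seq T) (U W : {vspace vT}) : uniq L ->
    {in L, forall t, f t \in U} ->
    (forall v, v \in U -> exists2 s, s \in <<map f L>>%VS & v - s \in W) ->
    (forall c : T -> F, \sum_(t <- L) c t *: f t \in W -> {in L, forall t, c t = 0}) ->
  basis_of (subquot U W) [seq vpi W (f t) | t <- L].
Proof.
move=> UL fU spanU indep; apply/andP; split; last first.
  apply: free_map => // c sum0; apply: indep.
  rewrite -vpi_eq0 linear_sum; apply/eqP; rewrite -[RHS]sum0.
  by apply: eq_bigr => t _; rewrite linearZ.
have -> : [seq vpi W (f t) | t <- L] = map (linfun (vpi W)) (map f L).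
  by rewrite -map_comp; apply: eq_map => t; rewrite /= lfunE.
rewrite -limg_span eqEsubv; apply/andP; split.
  by apply: limgS; apply/span_subvP=> _ /mapP[t /fU ? ->].
apply/subvP=> _ /memv_imgP[v /spanU[s sL vsW] ->].
have /eqP eqvs : vpi W v == vpi W s by rewrite vpi_eq.
by rewrite lfunE [X in X \in _]eqvs -[vpi W s](lfunE (vpi W)) memv_img.
Qed.

(** * From p-standard fillings to pairs of rows *)

Section Standard.

Variables (F : fieldType) (p n' k : nat).
Local Notation n := n'.+1.
Hypotheses (le_2k_n : (2 * k <= n)%N) (le_n_2k : (n - 2 * k <= p - 2)%N).
Implicit Types t : filling n k.

Definition rows t := (codom (top t), codom (bot t)).

Lemma nth_codom_ord (T : Type) (d : T) m (f : 'I_m -> T) (i : 'I_m) :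
  nth d (codom f) i = f i.
Proof. by rewrite (nth_map i) ?size_enum_ord // nth_ord_enum. Qed.

Lemma pairwise_codom m (f : 'I_m -> 'I_n) :
  (forall i j : 'I_m, (i < j)%N -> (f i < f j)%N) ->
  pairwise (fun x y : 'I_n => (x < y)%N) (codom f).
Proof.
move=> mono_f; rewrite pairwise_map.
apply: (@sub_pairwise _ (relpre val ltn)); first exact: mono_f.
by rewrite -pairwise_map val_enum_ord -sorted_pairwise ?iota_ltn_sorted //; apply: ltn_trans.
Qed.

Lemma rows_pstd t : t \in pstandard n k p -> pstd p n k (rows t).
Proof.
rewrite inE => /and3P[tabt /and3P[top_lt bot_lt col] pcol].
split; split=> //=.
- by rewrite size_codom card_ord.
- by lia.
- exact: tableau_uniq tabt.
- move=> x; rewrite ltn_ord mem_cat; move: tabt; rewrite inE => /andP[_ /forallP/(_ x)].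
  by case/codomP=> -[j|j] ->; apply/orP; [left|right]; apply: codom_f.
- by apply: pairwise_codom => i j; move/forallP/(_ i)/forallP/(_ j)/implyP: top_lt.
- by apply: pairwise_codom => i j; move/forallP/(_ i)/forallP/(_ j)/implyP: bot_lt.
- move=> j lt_jk; have lt_jnk : (j < n - k)%N by lia.
  rewrite (nth_codom_ord _ _ (Ordinal lt_jk)) (nth_codom_ord _ _ (Ordinal lt_jnk)).
  by move/forallP/(_ (Ordinal lt_jnk))/forallP/(_ (Ordinal lt_jk))/implyP: col; apply.
move=> j lt_jk; rewrite size_codom card_ord => lt_j.
rewrite (nth_codom_ord _ _ (Ordinal lt_jk)) (nth_codom_ord _ _ (Ordinal lt_j)).
by move/forallP/(_ (Ordinal lt_jk))/forallP/(_ (Ordinal lt_j))/implyP: pcol; apply.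
Qed.

Lemma pstd_rows r : pstd p n k r -> exists2 t, t \in pstandard n k p & rows t = r.
Proof.
move=> Pr; have := pstd_size (leqnn n) Pr.
case: Pr => -[sz2 rg Ur mr] [p1 p2 col pcol] sz1.
have {}sz1 : size r.1 = (n - k)%N by lia.
pose t : filling n k :=
  [ffun c : 'I_(n - k) + 'I_k =>
     match c with inl j => nth ord0 r.1 j | inr j => nth ord0 r.2 j end].
have topE j : top t j = nth ord0 r.1 j by rewrite /top ffunE.
have botE j : bot t j = nth ord0 r.2 j by rewrite /bot ffunE.
have ltP (s : seq 'I_n) i j : pairwise (fun x y : 'I_n => (x < y)%N) s ->
    (j < size s)%N -> (i < j)%N -> (nth ord0 s i < nth ord0 s j)%N.
  move=> /(pairwiseP ord0) ps lt_js lt_ij; apply: ps => //.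
  by rewrite inE (ltn_trans lt_ij).
exists t; last first.
  rewrite [RHS]surjective_pairing /rows; congr (_, _);
    apply: (@eq_from_nth _ ord0); rewrite size_codom card_ord // => i lt_i.
    by rewrite (nth_codom_ord _ _ (Ordinal lt_i)) topE.
  by rewrite (nth_codom_ord _ _ (Ordinal lt_i)) botE.
rewrite inE; apply/and3P; split.
- have [U1 dis U2] : [/\ uniq r.1, ~~ has (mem r.1) r.2 & uniq r.2].
    by apply/and3P; rewrite -cat_uniq.
  rewrite inE; apply/andP; split.
    apply/injectiveP=> -[i|i] [j|j]; rewrite !ffunE => /eqP.
    - by rewrite nth_uniq ?sz1 // => /eqP/val_inj->.
    - move/eqP=> eij; case/hasP: dis; exists (nth ord0 r.2 j); first by rewrite mem_nth ?sz2.
      by rewrite -eij /= mem_nth ?sz1.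
    - move/eqP=> eij; case/hasP: dis; exists (nth ord0 r.2 i); first by rewrite mem_nth ?sz2.
      by rewrite eij /= mem_nth ?sz1.
    by rewrite nth_uniq ?sz2 // => /eqP/val_inj->.
  apply/forallP=> x; have := mr x; rewrite ltn_ord mem_cat => /orP[] /(nthP ord0)[j].
    rewrite sz1 => lt_j <-; apply/codomP; exists (inl (Ordinal lt_j)); by rewrite ffunE.
  by rewrite sz2 => lt_j <-; apply/codomP; exists (inr (Ordinal lt_j)); rewrite ffunE.
- apply/and3P; split; apply/forallP=> i; apply/forallP=> j; apply/implyP.
  + by rewrite !topE; apply: ltP; rewrite ?sz1.
  + by rewrite !botE; apply: ltP; rewrite ?sz2.
  by move/eqP=> eij; rewrite topE botE eij; apply: col.
apply/forallP=> j; apply/forallP=> i; apply/implyP=> /eqP eij.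
by rewrite topE botE eij; apply: pcol; rewrite // -eij sz1.
Qed.

Lemma perm_pstandard_walks :
  perm_eq [seq rows t | t in pstandard n k p] (walks p n' n k).
Proof.
apply: uniq_perm; last 1 first.
- move=> r; apply/imageP/(walksP _ _ _ (leqnn n)) => [[t Pt ->]|]; first exact: rows_pstd.
  by case/pstd_rows=> t Pt <-; exists t.
- rewrite map_inj_uniq ?enum_uniq // => t t' [et eb]; apply/ffunP=> -[j|j].
    by rewrite -![t (inl j)]/(top t j) -![t' (inl j)]/(top t' j) -!(nth_codom_ord ord0) et.
  by rewrite -![t (inr j)]/(bot t j) -![t' (inr j)]/(bot t' j) -!(nth_codom_ord ord0) eb.
exact: walks_uniq.
Qed.

(** The map f is arbitrary in order to serve for both quotients. *)
Lemma perm_pstandard_polyrows (U : eqType) (f : subsetMod F n -> U) :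
  perm_eq [seq f (polytabloid F t) | t in pstandard n k p]
          [seq f (polyrows F r) | r <- walks p n' n k].
Proof.
have -> : [seq f (polytabloid F t) | t in pstandard n k p]
        = [seq f (polyrows F r) | r <- [seq rows t | t in pstandard n k p]].
  rewrite -map_comp; apply/eq_in_map=> t; rewrite mem_enum inE => /andP[tabt _] /=.
  by rewrite polytabloidE.
exact: perm_map perm_pstandard_walks.
Qed.

End Standard.

(** * Submodules and James' submodule theorem *)

Section Submodules.

Variables (F : fieldType) (n : nat).
Local Notation V := (subsetMod F n).
Local Notation W := (prefixSpace F n).
Implicit Types (U M : {vspace V}) (s : 'S_n) (v x : V) (k : nat).

Lemma submoduleP U :
  submodule U <-> forall s v, v \in U -> permAct F s v \in U.
Proof.
split=> [subU s v Uv|subU s]; first by apply: (subvP (subU s)); apply: memv_img.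
by apply/subvP=> _ /memv_imgP[v Uv ->]; apply: subU.
Qed.

Lemma Im_phi_iterP j k v :
  reflect (exists2 w, w \in W n k & v = iter j (phi F n) w)
          (v \in Im_phi_iter F n j k).
Proof.
have iterE w : phi_iter F n j w = iter j (phi F n) w.
  by elim: j => [|j IHj]; rewrite /= ?id_lfunE // comp_lfunE IHj.
rewrite /Im_phi_iter FOmegaE.
apply: (iffP memv_imgP) => [[w Ww ->]|[w Ww ->]]; exists w => //; exact: iterE.
Qed.

Lemma submodule_Im_phi_iter j k : submodule (Im_phi_iter F n j k).
Proof.
apply/submoduleP=> s v /Im_phi_iterP[w Ww ->]; apply/Im_phi_iterP.
exists (permAct F s w); first exact: permAct_W.
by elim: j => //= j <-; apply: permAct_phi.
Qed.

Lemma submodule_cap U M : submodule U -> submodule M -> submodule (U :&: M).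
Proof.
move=> /submoduleP subU /submoduleP subM; apply/submoduleP=> s v.
by rewrite !memv_cap => /andP[/subU-> /subM->].
Qed.

Lemma submodule_Specht k : (2 * k <= n)%N -> submodule (Specht F n k).
Proof.
move=> le_2k_n; apply/submoduleP=> s v Sv.
pose P v := permAct F s v \in Specht F n k.
apply: (span_ind (P := P)) Sv => [|a _ u /imageP[t tabt ->] Pu].
  by rewrite /P linear0 mem0v.
rewrite /P linearP rpredD ?rpredZ //=.
have [t' tabt' ->] := permAct_polytabloid F le_2k_n s tabt.
by rewrite memv_span // image_f.
Qed.

Lemma Specht_sub_Ker k : (2 * k <= n)%N -> (Specht F n k <= Ker_phi F n k)%VS.
Proof.
move=> le_2k_n; apply/span_subvP=> _ /imageP[t tabt ->].
by rewrite memv_cap FOmegaE polytabloid_W //= memv_ker phi_polytabloid.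
Qed.

(** If an element of M pairs nontrivially with a polytabloid, its signed column sum is a nonzero
    multiple of that polytabloid and lies in M; permutations then yield all the others. *)
Lemma James_dichotomy k M : (2 * k <= n)%N -> submodule M -> (M <= W n k)%VS ->
  (Specht F n k <= M)%VS \/
  (forall x y : V, x \in M -> y \in Specht F n k -> dot x y = 0).
Proof.
move=> le_2k_n /submoduleP subM sMW.
(* Testing on a basis of M makes the alternative decidable. *)
case: (boolP [exists t in tableau n k,
  has (fun x => dot (polytabloid F t) x != 0) (vbasis M)]).
  case/exists_inP=> t tabt /hasP[x /vbasis_mem Mx nz]; left.
  have Mt : polytabloid F t \in M.
    have := kappa_colstab le_2k_n tabt (subvP sMW _ Mx).
    rewrite -polytabloidE // => eq_kappa.
    rewrite -[polytabloid F t](scalerK nz) rpredZ // -eq_kappa.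
    by apply: rpred_sum => s _; rewrite rpredZ ?subM.
  apply/span_subvP=> _ /imageP[t' tabt' ->].
  by have [s <-] := tableau_transitive F le_2k_n tabt tabt'; apply: subM.
move=> none; right=> x s Mx Ss; rewrite dotC.
apply: (span_ind (P := fun s : V => dot s x = 0)) Ss => [|a _ u /imageP[t tabt ->] u0].
  by rewrite dotC linear0.
rewrite dotDl dotZl u0 addr0; have -> : dot (polytabloid F t) x = 0; last exact: mulr0.
rewrite -(span_basis (vbasisP M)) in Mx.
apply: (span_ind (P := fun x : V => dot (polytabloid F t) x = 0)) Mx => [|b y z yM z0].
  exact: linear0.
rewrite linearP /= z0 addr0; apply/eqP; rewrite scaler_eq0; apply/orP; right.
apply: contraNT none => nz; apply/exists_inP; exists t => //.
by apply/hasP; exists y.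
Qed.

End Submodules.

(** * The homology group and the top of the Specht module *)

Section Homology.

Variables (p : nat) (F : fieldType) (n' k : nat).
Local Notation n := n'.+1.
Hypotheses (charF : p \in [pchar F]) (le_2k_n : (2 * k <= n)%N)
  (le_n_2k : (n - 2 * k <= p - 2)%N).
Local Notation V := (subsetMod F n).
Local Notation W := (prefixSpace F n).
Local Notation phi := (phi F n).
Local Notation L := (walks p n' n k).
Local Notation Im := (Im_phi_iter F n (p - 1) (k + p - 1)).
Local Notation Ker := (Ker_phi F n k).
Local Notation S := (Specht F n k).
Local Notation polyrows := (@polyrows F n').

Let p_gt1 : (1 < p)%N.
Proof. exact/prime_gt1/(pcharf_prime charF). Qed.

Lemma memIm v :
  reflect (exists2 w, w \in W n (k + p.-1) & v = iter p.-1 phi w) (v \in Im).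
Proof. by rewrite -addnBA ?(ltnW p_gt1) // subn1; apply: Im_phi_iterP. Qed.

Lemma memKer v : (v \in Ker) = (v \in W n k) && (phi v == 0).
Proof. by rewrite memv_cap FOmegaE memv_ker. Qed.

(** The adjoint of [phi^(p-1)] is [raise^(p-1)], which kills u because n - 2k + 1 <= p - 1. *)
Lemma dot_Im_lowest_weight v u : v \in Im -> lowest_weight n k u -> dot v u = 0.
Proof.
case/memIm=> w Ww -> [_ _ eu]; rewrite (dot_iter_phi _ Ww).
have -> : p.-1 = ((p.-1 - (n - k.*2).+1) + (n - k.*2).+1)%N by lia.
by rewrite iterD eu (linear0 (iter _ (raise n))) linear0.
Qed.

Lemma polyrows_Specht : {in L, forall r, polyrows r \in S}.
Proof.
move=> r /(walksP _ _ _ (leqnn n)) /(pstd_rows le_2k_n le_n_2k)[t].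
rewrite inE => /andP[tabt _] <-; rewrite /polyrows -polytabloidE //.
by rewrite memv_span // image_f.
Qed.

Lemma Ker_spanned v : v \in Ker ->
  exists2 s, s \in <<map polyrows L>>%VS & v - s \in Im.
Proof.
rewrite memKer => /andP[Wv /eqP phiv].
have [||w Ww sv] := kernel_spanned charF (leqnn n) _ _ Wv phiv; try lia.
exists (v - iter p.-1 phi w) => //; rewrite subKr.
by apply/memIm; exists w.
Qed.

Lemma walks_independent_Im (c : _ -> F) :
  \sum_(r <- L) c r *: polyrows r \in Im -> {in L, forall r, c r = 0}.
Proof.
move=> sumI; apply: (walks_independent charF (leqnn n)) => u.
exact: dot_Im_lowest_weight.
Qed.

Lemma homology_basis :
  basis_of (subquot Ker Im) [seq vpi Im (polytabloid F t) | t in pstandard n k p].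
Proof.
have pr := perm_pstandard_polyrows le_2k_n le_n_2k (vpi Im).
rewrite (perm_basis _ pr); apply: basis_subquot.
- exact: walks_uniq.
- by move=> r /polyrows_Specht; apply: (subvP (Specht_sub_Ker _ le_2k_n)).
- exact: Ker_spanned.
exact: walks_independent_Im.
Qed.

Section OddCharacteristic.

Hypothesis p_gt2 : (2 < p)%N.

(** There is at least one walk, and by independence its polytabloid is not in the image. *)
Lemma Specht_nsub_Im : ~ (S <= Im)%VS.
Proof.
move=> sSI; have rg : (k.*2 <= n <= k.*2 + (p - 2))%N by lia.
have := walks_neq_nil n' p_gt2 rg; case def_L: L => [//|r L'] _.
have rL : r \in L by rewrite def_L mem_head.
have := walks_independent_Im (c := fun q => (q == r)%:R) _ rL.
rewrite eqxx => /(_ _)/eqP; rewrite oner_eq0 => H; apply/notF/H.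
apply: (subvP sSI); rewrite big_seq; apply: rpred_sum => q qL.
by rewrite rpredZ // polyrows_Specht.
Qed.

Lemma Im_orth_Specht x s : x \in Im -> s \in S -> dot x s = 0.
Proof.
have sIW : (Im <= W n k)%VS.
  by apply/subvP=> _ /memIm[w Ww ->]; apply: iter_phi_W.
have [/Specht_nsub_Im//|] := James_dichotomy le_2k_n (@submodule_Im_phi_iter F n _ _) sIW.
exact.
Qed.

(* Every test vector is, like every element of the kernel of phi, the sum of an
   element of the Specht module and of one of the image. *)
Lemma Specht_radical_sub_Im x :
  x \in S -> (forall s, s \in S -> dot x s = 0) -> x \in Im.
Proof.
move=> Sx orth; have KerS := subvP (Specht_sub_Ker F le_2k_n).
have [y yL xyI] := Ker_spanned (KerS _ Sx).
have [c def_y] := span_map_sum (walks_uniq _ _ (leqnn n)) yL.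
suff c0 : {in L, forall r, c r = 0}.
  rewrite (_ : y = 0) ?subr0 // in xyI; rewrite def_y big_seq big1 // => r rL.
  by rewrite c0 ?scale0r.
apply: (walks_independent charF (leqnn n)) => u Tu; rewrite -def_y.
have -> : y = x - (x - y) by rewrite subKr.
rewrite dotBl (dot_Im_lowest_weight xyI Tu) subr0.
have [|s sL usI] := @Ker_spanned u; first by case: Tu; rewrite memKer => -> ->/=.
have Ss : s \in S.
  apply: subvP sL; apply/span_subvP=> _ /mapP[r rL ->]; exact: polyrows_Specht.
rewrite -(subrK s u) linearD /= (orth _ Ss) addr0 dotC.
exact: Im_orth_Specht.
Qed.

Lemma jrad_Specht v : (v \in jrad S) = (v \in S) && (v \in Im).
Proof.
rewrite -memv_cap; set R := (S :&: Im)%VS.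
have subS := submodule_Specht F le_2k_n.
(* A proper submodule cannot contain S, so the dichotomy makes it orthogonal to S and hence part of
   the image. *)
have proper N : submodule N -> (N <= S)%VS -> N <> S -> (N <= R)%VS.
  move=> subN sNS neqNS; rewrite subv_cap sNS /=.
  have sNW : (N <= W n k)%VS.
    apply: subv_trans sNS (subv_trans (Specht_sub_Ker F le_2k_n) _).
    by rewrite /Ker_phi FOmegaE capvSl.
  have [sSN|orth] := James_dichotomy le_2k_n subN sNW.
    by case: neqNS; apply/eqP; rewrite eqEsubv sNS.
  apply/subvP=> x Nx; apply: Specht_radical_sub_Im; first exact: (subvP sNS).
  by move=> s; apply: orth.
have neqRS : R <> S by move=> eqRS; apply: Specht_nsub_Im; rewrite -eqRS capvSr.
have subR : submodule R by apply: submodule_cap => //; apply: submodule_Im_phi_iter.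
have maxR : maximal_submodule S R.
  split=> //; first exact: capvSl.
  move=> N subN sRN sNS; have [/eqP->|neqNS] := boolP (N == S); first by right.
  by left; apply/eqP; rewrite eqEsubv sRN proper // => /eqP; rewrite (negPf neqNS).
apply/idP/idP=> [/jradP[_ /(_ R maxR)]//|Rv].
apply/jradP; split=> [|M [subM sMS neqMS maxM]]; first exact: (subvP (capvSl _ _)) Rv.
(* Any maximal submodule M lies in R, so M = R by maximality. *)
by have [<-|//] := maxM R subR (proper _ subM sMS neqMS) (capvSl _ _).
Qed.

Lemma Specht_top_basis :
  basis_of (subquot S (jrad S))
    [seq vpi (jrad S) (polytabloid F t) | t in pstandard n k p].
Proof.
have pr := perm_pstandard_polyrows le_2k_n le_n_2k (vpi (jrad S)).
rewrite (perm_basis _ pr); apply: basis_subquot.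
- exact: walks_uniq.
- exact: polyrows_Specht.
- move=> v Sv; have [s sL vsI] := Ker_spanned (subvP (Specht_sub_Ker F le_2k_n) _ Sv).
  exists s; rewrite // jrad_Specht vsI andbT rpredB //.
  apply: subvP sL; apply/span_subvP=> _ /mapP[r rL ->]; exact: polyrows_Specht.
by move=> c; rewrite jrad_Specht => /andP[_]; apply: walks_independent_Im.
Qed.

End OddCharacteristic.

End Homology.

Theorem theorem5p3 (p : nat) (F : fieldType) (n k : nat)
    (p_pr : prime p) (charF : p \in [pchar F]) (n_gt0 : (0 < n)%N)
    (le_2k_n : (2 * k <= n)%N) (le_n_2k : (n - 2 * k <= p - 2)%N) :
  let Im := Im_phi_iter F n (p - 1) (k + p - 1) in
  let S := Specht F n k in
  basis_of (subquot (Ker_phi F n k) Im)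
    [seq vpi Im (polytabloid F t) | t in pstandard n k p]
  /\ (p <> 2%N ->
      basis_of (subquot S (jrad S))
        [seq vpi (jrad S) (polytabloid F t) | t in pstandard n k p]).
Proof.
(* A successor provides the point [ord0], the default value in rows. *)
case: n n_gt0 le_2k_n le_n_2k => [//|n'] _ le_2k_n le_n_2k Im S; split.
  exact: homology_basis.
move=> p_neq2; apply: Specht_top_basis => //.
by rewrite ltn_neqAle eq_sym prime_gt1 // andbT; apply/eqP.
Qed.
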